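(* Let $\Gamma$ be a completed graph in $d=2\lambda+2>2$ dimensions whose graphical function $f^{(\lambda)}_\Gamma$ converges. For labels $a,b\in\{0,1,z,\infty\}$ let $\Gamma_{(ab)}$ denote $\Gamma$ with the labels $a$ and $b$ interchanged. Then, as functions of $z\in\mathbb{C}\setminus\{0,1\}$, $$f^{(\lambda)}_\Gamma(z)=f^{(\lambda)}_{\Gamma_{(0\infty)}}(1/z),\qquad f^{(\lambda)}_\Gamma(z)=f^{(\lambda)}_{\Gamma_{(01)}}(1-z),\qquad f^{(\lambda)}_\Gamma(z)=f^{(\lambda)}_{\Gamma_{(1z)}}(1/z).$$ Consequently, for every permutation $\sigma$ of $\{0,1,z,\infty\}$, $f^{(\lambda)}_\Gamma(z)=f^{(\lambda)}_{\sigma(\Gamma)}(\phi(\sigma)(z))$, where $\phi$ is the homomorphism to the group of Möbius transformations permuting $\{0,1,\infty\}$ determined by $\phi((0\infty))=\phi((1z))=(z\mapsto1/z)$ and $\phi((01))=(z\mapsto1-z)$.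
   Context: A completed graph $\Gamma$ in $d=2\lambda+2$ dimensions has labeled vertices $0,1,z,\infty$ and real edge weights $\nu_e$ such that each unlabeled vertex has weighted valency $2d/(d-2)$ and each labeled vertex weighted valency $0$. Its graphical function is $f^{(\lambda)}_\Gamma(z)=\Big(\prod_{v\notin\{0,1,z,\infty\}}\int_{\mathbb{R}^d}\frac{d^dx_v}{\pi^{d/2}}\Big)\prod_e\|x_e-y_e\|^{-2\lambda\nu_e}$, where edges incident to $\infty$ and the edge between $0$ and $1$ contribute the factor $1$, $0$ is the origin, $1$ a unit vector $e_1$. It depends only on $\|z\|$ and the angle with $e_1$ and is regarded as a function of complex $z$ (identifying $e_1$ with $1$); it satisfies $f(z)=f(\bar z)$. *)

(* Defs.v *)
From HB Require Import structures.
From mathcomp Require Import all_boot all_order all_algebra all_fingroup.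
From mathcomp Require Import all_classical all_reals all_analysis.
From mathcomp Require Import complex.
Set Implicit Arguments. Unset Strict Implicit. Unset Printing Implicit Defensive.
Import Order.TTheory GRing.Theory Num.Theory.
Local Open Scope ring_scope.

Definition label := 'I_4.
Definition L0 : label := @Ordinal 4 0 isT.
Definition L1 : label := @Ordinal 4 1 isT.
Definition Lz : label := @Ordinal 4 2 isT.
Definition Linf : label := @Ordinal 4 3 isT.

Definition vertex (n : nat) := (label + 'I_n)%type.

Record wgraph (R : realType) := WGraph {
  nint : nat;
  edges : seq (vertex nint * vertex nint * R) }.

Definition valency (R : realType) (G : wgraph R) (v : vertex (nint G)) : R :=
  \sum_(e <- edges G)
     ((if e.1.1 == v then e.2 else 0) + (if e.1.2 == v then e.2 else 0)).

Definition lambda (R : realType) (d : nat) : R := (d%:R - 2) / 2.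

Definition completed (R : realType) (d : nat) (G : wgraph R) : Prop :=
  [/\ (forall e, e \in edges G -> e.1.1 != e.1.2),
      (forall i : 'I_(nint G), @valency R G (inr i) = 2 * d%:R / (d%:R - 2)) &
      (forall a : label, @valency R G (inl a) = 0)].

Definition relabel_vertex n (s : {perm label}) (v : vertex n) : vertex n :=
  match v with inl a => inl (s a) | inr i => inr i end.

Definition relabel (R : realType) (s : {perm label}) (G : wgraph R) : wgraph R :=
  @WGraph R (nint G)
    [seq (relabel_vertex s e.1.1, relabel_vertex s e.1.2, e.2) | e <- edges G].

Definition eucl_dist (R : realType) (d : nat) (p q : 'I_d -> R) : R :=
  Num.sqrt (\sum_(k < d) (p k - q k) ^+ 2).

(* Position of a vertex: 0 |-> origin, 1 |-> e_1, z |-> Re z e_1 + Im z e_2,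
   oo |-> None (point at infinity), internal vertex i |-> its coordinates,
   read off the list s of all n*d integration variables (vertex i occupies
   the entries i*d, ..., i*d + d - 1). *)
Definition position (R : realType) (d n : nat) (z : R[i]) (s : seq R)
  (v : vertex n) : option ('I_d -> R) :=
  match v with
  | inl a =>
      if a == Linf then None
      else if a == L0 then Some (fun _ => 0)
      else if a == L1 then Some (fun k => if val k == 0%N then 1 else 0)
      else Some (fun k => if val k == 0%N then complex.Re z
                          else if val k == 1%N then complex.Im z else 0)
  | inr i => Some (fun k : 'I_d => nth 0 s (i * d + k)%N)
  end.

(* Factor of one edge: ||x_e - y_e||^(-2 lambda nu_e); edges incident to oo
   contribute 1 (the edge between 0 and 1 contributes ||e_1||^.. = 1). *)
Definition edge_factor (R : realType) (d n : nat) (z : R[i]) (s : seq R)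
  (e : vertex n * vertex n * R) : R :=
  match position d z s e.1.1, position d z s e.1.2 with
  | Some p, Some q => (eucl_dist p q) `^ (- (2 * lambda R d * e.2))
  | _, _ => 1
  end.

Definition integrand (R : realType) (d : nat) (G : wgraph R) (z : R[i])
  (s : seq R) : R :=
  \prod_(e <- edges G) edge_factor d z s e.

(* Iterated Lebesgue integral over R^k of a function of k real variables
   (given as a list); by Tonelli this is the integral over R^k for the
   non-negative integrands used below. *)
Fixpoint iint (R : realType) (k : nat) (F : seq R -> \bar R) : \bar R :=
  match k with
  | 0%N => F [::]
  | k'.+1 => (\int[@lebesgue_measure R]_x iint k' (fun s => F (x :: s)))%E
  end.

(* The graphical function f^(lambda)_G(z), with the normalisation
   d^d x_v / pi^(d/2) for every unlabeled vertex v; value in [0, +oo]. *)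
Definition graphical_function (R : realType) (d : nat) (G : wgraph R)
  (z : R[i]) : \bar R :=
  ((pi `^ (- ((nint G * d)%:R / 2)))%:E
     * iint (nint G * d) (fun s => (integrand d G z s)%:E))%E.

Definition gf_converges (R : realType) (d : nat) (G : wgraph R) : Prop :=
  forall z : R[i], z != 0 -> z != 1 -> graphical_function d G z \is a fin_num.

(* Main.v *)
Require Import Defs.
From HB Require Import structures.
From mathcomp Require Import all_boot all_order all_algebra all_fingroup.
From mathcomp Require Import all_classical all_reals all_analysis.
From mathcomp Require Import measurable_realfun complex ring.
Import Order.TTheory GRing.Theory Num.Theory.
Local Open Scope ring_scope.
Set Implicit Arguments. Unset Strict Implicit. Unset Printing Implicit Defensive.

(** The similarities x |-> e_1 - x and x |-> z x and the inversion
    x |-> x / |x|^2 followed by a reflection act on the labels 0, 1, z, oo as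
    required. Each satisfies |phi x - phi y| = m(x) m(y) |x - y|, so the product
    of the edge factors changes by prod_v m(v)^(-2 lambda valency(v)); for a
    completed graph this is prod_i m(x_i)^(-2d) over the unlabeled vertices,
    which cancels the Jacobians.

    All changes of variables are reduced to one-dimensional ones by Tonelli's
    theorem. In dimension one, affine substitutions come from the uniqueness of
    Lebesgue measure, and t |-> 1/t preserves dt/|t| by the uniqueness argument
    for Haar measure. *)

(** All integration variables form one flat list while the geometry acts on one vertex at a time, so
    a change of variables is stated for a block of [d] entries ([blockmap]) and then spread over the
    vertices.

    The identity with m must also hold at the point oo, whose distance to everything reads 1. This
    dictates m at oo, and at the labels that are moved to or from it; the zero valency of labels is
    what makes these values disappear from the product.

    Inversion is singular at the origin, and its reduction to one variable divides by the first
    coordinate. Hence the identities are only required off the hyperplane where that coordinate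
    vanishes, and the indicator of its complement is carried along as a second density [K].

    Since (0 oo) and (1 z) have the same image, phi is not injective, and prescribing it on
    generators would require checking relations. It is instead given by a closed formula, the
    cross-ratio of the four relabeled points, from which the homomorphism property follows by
    projective invariance. *)

Local Notation leb := (@lebesgue_measure _).

(** * Affine substitutions and reciprocals on the real line *)

Lemma ge0_integral_affine (R : realType) (a b : R) (f : measurableTypeR R -> \bar R) :
  a != 0 -> measurable_fun setT f -> (forall x, 0 <= f x)%E ->
  (\int[leb]_x f x = `|a|%:E * \int[leb]_x f (a * x + b)%R)%E.
Proof.
move=> a0 mf f0.
pose phi := fun x : measurableTypeR R => a * x + b : measurableTypeR R.
have mphi : measurable_fun setT phi.
  by apply: measurable_funD => //; exact: measurable_funM.
have na : 0 <= `|a| by [].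
pose nu0 : {measure set (measurableTypeR R) -> \bar R} :=
  mscale (NngNum na) (pushforward (@lebesgue_measure R) phi).
pose nu := nu0 mphi.
have E A : measurable A -> lebesgue_measure A = nu A.
  apply: lebesgue_measure_unique => _ [[p q] _ <-].
  rewrite /nu /nu0 /= /mscale /= /pushforward lebesgue_measure_itv /= lte_fin.
  have [a1|a1|a1] := ltgtP a 0; last by rewrite a1 eqxx in a0.
  - rewrite (_ : (phi @^-1` _)%classic = `[(q - b) / a, (p - b) / a[%classic).
      rewrite lebesgue_measure_itv /= lte_fin ltr_ndivrMr // divfK // ltrD2r.
      case: ifPn => _; rewrite ?mule0 // -!EFinB -EFinM; congr (_%:E).
      by rewrite ltr0_norm //; field.
    apply/seteqP; split => x /=;
      by rewrite /phi !in_itv /= ler_ndivrMr // ltr_ndivlMr // lerBrDr ltrBlDr mulrC andbC.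
  - rewrite (_ : (phi @^-1` _)%classic = `](p - b) / a, (q - b) / a]%classic).
      rewrite lebesgue_measure_itv /= lte_fin ltr_pdivrMr // divfK // ltrD2r.
      case: ifPn => _; rewrite ?mule0 // -!EFinB -EFinM; congr (_%:E).
      by rewrite gtr0_norm //; field.
    apply/seteqP; split => x /=;
      by rewrite /phi !in_itv /= ltr_pdivrMr // ler_pdivlMr // ltrBlDr lerBrDr mulrC.
rewrite (@eq_measure_integral _ _ _ _ nu leb) => [|A mA _]; last exact: E.
by rewrite /nu /nu0 ge0_integral_mscale //= ge0_integral_pushforward.
Qed.

(** Writing 1/y = y |y|^(-2) reduces the claim to real powers; at y = 0 both sides vanish because
    [0^-1 = 0]. *)
Lemma measurable_funV d (T : measurableType d) (R : realType) (f : T -> R) :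
  measurable_fun setT f -> measurable_fun setT (fun x => (f x)^-1).
Proof.
move=> mf; rewrite (_ : (fun x => _) = (fun x => f x * (`|f x| `^ (-1) * `|f x| `^ (-1)))).
  have h : measurable_fun setT (fun x => `|f x| `^ (-1)).
    by apply: (measurableT_comp (measurable_powR _)); exact: measurableT_comp.
  by apply: measurable_funM => //; exact: measurable_funM.
apply/funext => x; rewrite powR_inv1 //.
have [->|fx0] := eqVneq (f x) 0; first by rewrite invr0 mul0r.
by rewrite -invfM -normrM ger0_norm -?expr2 ?sqr_ge0 // expr2 invfM mulrA mulfV // mul1r.
Qed.

Lemma measurable_funnormV d (T : measurableType d) (R : realType) (f : T -> R) :
  measurable_fun setT f -> measurable_fun setT (fun x => `|f x|^-1).
Proof. by move=> mf; apply: measurable_funV; exact: measurableT_comp. Qed.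

(** * Haar measure of the multiplicative group of the reals *)

Section haar.
Variable R : realType.
Local Notation mT := (measurableTypeR R).

(** Since [0^-1 = 0], the density vanishes at 0, so the value [f 0] never contributes, even when it
    is infinite. *)
Definition haar (f : mT -> \bar R) : \bar R :=
  (\int[leb]_x (`|x|^-1%:E * f x))%E.

Lemma haar_scale (a : R) (f : mT -> \bar R) :
  a != 0 -> measurable_fun setT f -> (forall x, 0 <= f x)%E ->
  haar (fun x => f (a * x)) = haar f.
Proof.
move=> a0 mf f0; rewrite /haar.
have mh : measurable_fun setT (fun x : mT => (`|x|^-1%:E * f x)%E).
  by apply: emeasurable_funM => //; apply/measurable_EFinP; exact: measurable_funnormV.
have h0 x : (0 <= `|x|^-1%:E * f x)%E by rewrite mule_ge0 // lee_fin.
rewrite [RHS](@ge0_integral_affine _ a 0) // -ge0_integralZl //=.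
- apply: eq_integral => x _.
  by rewrite addr0 muleA -EFinM normrM invfM mulrA mulfV ?mul1r// normr_eq0 //.
- apply: (measurableT_comp mh).
  by apply: measurable_funD => //; exact: measurable_funM.
Qed.

Lemma haar_bump : haar (fun x : mT => (`|x| * \1_(`]0, 1]%classic : set R) x)%:E) = 1%E.
Proof.
rewrite /haar; transitivity (\int[leb]_(x in (setT : set mT)) (\1_(`]0, 1]%classic : set R) x)%:E)%E.
  apply: eq_integral => x _; rewrite -EFinM mulrA; congr (_%:E).
  have [->|x0] := eqVneq x 0; last by rewrite mulVf ?mul1r // normr_eq0.
  by rewrite normr0 mulr0 mul0r indicE memNset //= in_itv /= ltxx.
rewrite integral_indic //= setIT lebesgue_measure_itv /= lte_fin ltr01.
by rewrite -EFinB subr0.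
Qed.

(** Uniqueness of Haar measure: insert [1 = haar g], which by invariance is the integral of g(ts)
    ds/|s|; exchange the integrals, replace t by t/s, and exchange back. What remains is [haar g]
    times [haar f]. *)
Lemma haar_inv (f : mT -> \bar R) :
  measurable_fun setT f -> (forall x, 0 <= f x)%E ->
  haar (fun x => f x^-1) = haar f.
Proof.
move=> mf f0.
pose g := fun x : mT => (`|x| * \1_(`]0, 1]%classic : set R) x)%:E : \bar R.
have mg : measurable_fun setT g.
  by apply/measurable_EFinP; apply: measurable_funM.
have g0 x : (0 <= g x)%E by rewrite lee_fin mulr_ge0.
have gg : haar g = 1%E := haar_bump.
have nV0 (x : R) : (0 <= `|x|^-1%:E)%E by rewrite lee_fin.
have mN1 : measurable_fun setT (fun p : mT * mT => `|p.1|^-1%:E).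
  by apply/measurable_EFinP; apply: measurable_funnormV; exact: measurable_fst.
have mN2 : measurable_fun setT (fun p : mT * mT => `|p.2|^-1%:E).
  by apply/measurable_EFinP; apply: measurable_funnormV; exact: measurable_snd.
have mN : measurable_fun setT (fun x : mT => `|x|^-1%:E).
  by apply/measurable_EFinP; apply: measurable_funnormV.
have mV : measurable_fun setT (fun x : mT => f x^-1).
  by apply: (measurableT_comp mf); exact: measurable_funV.
have hV0 : (0 <= haar f)%E by apply: integral_ge0 => x _; rewrite mule_ge0.
transitivity (\int[leb]_(t in (setT : set mT)) \int[leb]_(s in (setT : set mT))
   (`|t|^-1%:E * (`|s|^-1%:E * (g (t * s)%R * f (t^-1)%R))))%E.
  rewrite /haar; apply: eq_integral => t _.
  rewrite ge0_integralZl //=.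
  - have [->|t0] := eqVneq t 0; first by rewrite normr0 invr0 !mul0e.
    congr (_ * _)%E; rewrite -[LHS]mul1e -gg -(haar_scale t0 mg) //.
    rewrite /haar -ge0_integralZr //.
    + by apply: eq_integral => s _; rewrite muleA.
    + apply: emeasurable_funM => //; apply: (measurableT_comp mg).
      exact: measurable_funM.
    + by move=> x _; rewrite mule_ge0.
  - apply: emeasurable_funM => //; apply: emeasurable_funM => //.
    by apply: (measurableT_comp mg); exact: measurable_funM.
  - by move=> x _; rewrite !mule_ge0.
rewrite (fubini_tonelli (fun p : mT * mT =>
   (`|p.1|^-1%:E * (`|p.2|^-1%:E * (g (p.1 * p.2)%R * f (p.1^-1)%R))))%E); last 2 first.
- apply: emeasurable_funM => //; apply: emeasurable_funM => //.
  apply: emeasurable_funM.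
    by apply: (measurableT_comp mg); exact: measurable_funM.
  by apply: (measurableT_comp mV).
- by move=> x; rewrite !mule_ge0.
transitivity (\int[leb]_(s in (setT : set mT)) \int[leb]_(t in (setT : set mT))
   (`|t|^-1%:E * (`|s|^-1%:E * (g t * f (t^-1 * s)%R))))%E.
  apply: eq_integral => s _ /=.
  have [->|s0] := eqVneq s 0.
    by under eq_integral do rewrite normr0 invr0 !mul0e mule0;
       under [RHS]eq_integral do rewrite normr0 invr0 !mul0e mule0.
  have := @haar_scale s (fun t => (`|s|^-1%:E * (g t * f (t^-1 * s)%R))%E) s0.
  rewrite /haar => <-.
  - apply: eq_integral => t _; rewrite mulrC invfM -mulrA [t^-1 * _]mulrC mulrA mulVf // mul1r.
    by rewrite mulrC.
  - apply: emeasurable_funM => //; apply: emeasurable_funM => //.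
    apply: (measurableT_comp mf); apply: measurable_funM => //.
    exact: measurable_funV.
  - by move=> t; rewrite !mule_ge0.
rewrite -(fubini_tonelli (fun p : mT * mT =>
   (`|p.1|^-1%:E * (`|p.2|^-1%:E * (g p.1 * f (p.1^-1 * p.2)%R))))%E); last 2 first.
- apply: emeasurable_funM => //; apply: emeasurable_funM => //.
  apply: emeasurable_funM.
    by apply: (measurableT_comp mg).
  apply: (measurableT_comp mf); apply: measurable_funM => //.
  by apply: measurable_funV.
- by move=> x; rewrite !mule_ge0.
rewrite /=; set hf := haar f.
rewrite -[RHS]mul1e -gg [in RHS]/haar -ge0_integralZr //; last 2 first.
- by apply: emeasurable_funM.
- by move=> x _; rewrite mule_ge0.

apply: eq_integral => t _.
have [->|t0] := eqVneq t 0.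
  rewrite normr0 invr0 !mul0e.
  by under eq_integral do rewrite mul0e; rewrite integral0.
rewrite /hf -(@haar_scale t^-1 f) ?invr_eq0 // /haar -[RHS]ge0_integralZl //.
- by apply: eq_integral => s _; rewrite -!muleA; congr (_ * _)%E; rewrite muleCA.
- apply: emeasurable_funM => //; apply: (measurableT_comp mf).
  exact: measurable_funM.
- by move=> x _; rewrite mule_ge0.
- by rewrite mule_ge0.
Qed.
End haar.

(** * The substitution t |-> c/t *)

Section one_dim.
Variable R : realType.
Local Notation mT := (measurableTypeR R).

Lemma measurable_neq0 d (T : measurableType d) (f : T -> R) :
  measurable_fun setT f -> measurable_fun setT (fun x => (f x != 0)%:R : R).
Proof.
move=> mf; rewrite (_ : (fun x => _) = (fun x => f x * (f x)^-1)).
  by apply: measurable_funM => //; exact: measurable_funV.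
by apply/funext => x; case: eqVneq => [->|fx0]; rewrite ?mul0r ?mulfV.
Qed.

Lemma ge0_integral_neq0 (f : mT -> \bar R) :
  measurable_fun setT f -> (forall x, 0 <= f x)%E ->
  (\int[leb]_x f x = \int[leb]_x ((x != 0)%:R%:E * f x))%E.
Proof.
move=> mf f0; apply: ge0_ae_eq_integral => //.
- apply: emeasurable_funM => //; apply/measurable_EFinP.
  exact: measurable_neq0.
- by move=> x _; rewrite mule_ge0 // lee_fin.
exists [set 0]%classic; split => //; first exact: lebesgue_measure_set1.
move=> x /= h; apply: contrapT => /eqP x0; apply: h => _.
by rewrite x0 mul1e.
Qed.

(** Lebesgue measure is |x| times Haar measure, which is invariant under scaling by c and under
    inversion; the density is |c/x| times 1/|x|. *)
Lemma ge0_integral_inversion (c : R) (f : mT -> \bar R) :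
  c != 0 -> measurable_fun setT f -> (forall x, 0 <= f x)%E ->
  (\int[leb]_x f x = \int[leb]_x ((`|c| * `|x|^-1 ^+ 2)%:E * f (c / x)%R))%E.
Proof.
move=> c0 mf f0.
have mn : measurable_fun setT (fun x : mT => (`|x| * 1)%:E * f x)%E.
  apply: emeasurable_funM => //; apply/measurable_EFinP.
  by apply: measurable_funM => //; exact: measurable_normr.
have n0 x : (0 <= (`|x| * 1)%:E * f x)%E by rewrite mule_ge0 // lee_fin mulr1.
transitivity (haar (fun x => (`|x| * 1)%:E * f x)%E).
  rewrite ge0_integral_neq0 // /haar; apply: eq_integral => x _.
  rewrite muleA -EFinM mulr1; congr (_%:E * _)%E.
  by case: eqVneq => [->|x0]; rewrite ?normr0 ?mulr0 // mulVf ?normr_eq0.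
rewrite -(haar_scale c0 mn) // -haar_inv; last 2 first.
- by apply: (measurableT_comp mn); exact: measurable_funM.
- by move=> x; exact: n0.
apply: eq_integral => x _; rewrite muleA -EFinM; congr (_%:E * _)%E.
by rewrite normrM normfV mulr1; ring.
Qed.

End one_dim.

(** * Measurability and Tonelli for iterated integrals over lists *)

Section lists.
Variable R : realType.
Local Notation mT := (measurableTypeR R).

Definition mseq d (T : measurableType d) k (g : T -> seq R) :=
  (forall t, size (g t) = k) /\
  (forall i, measurable_fun setT (fun t => nth 0 (g t) i)).

(** Measurability on lists of length [k] is tested along all measurable families of such lists, so
    no sigma-algebra on lists has to be fixed. *)
Definition mfunl k (F : seq R -> \bar R) :=
  forall d (T : measurableType d) (g : T -> seq R),
    mseq k g -> measurable_fun setT (fun t => F (g t)).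

Definition mreal k (f : seq R -> R) :=
  forall d (T : measurableType d) (g : T -> seq R),
    mseq k g -> measurable_fun setT (fun t => f (g t)).

Definition mmap j k (phi : seq R -> seq R) :=
  forall d (T : measurableType d) (g : T -> seq R),
    mseq j g -> mseq k (fun t => phi (g t)).

Lemma mseq_cons d (T : measurableType d) k (x : T -> R) (g : T -> seq R) :
  measurable_fun setT x -> mseq k g -> mseq k.+1 (fun t => x t :: g t).
Proof. by move=> mx [sg mg]; split => [t|[|i]] //=; rewrite sg. Qed.

Lemma mseq_cat d (T : measurableType d) j k (f g : T -> seq R) :
  mseq j f -> mseq k g -> mseq (j + k) (fun t => f t ++ g t).
Proof.
move=> [sf mf] [sg mg]; split => [t|i]; first by rewrite size_cat sf sg.
rewrite (_ : (fun t => _) = (fun t => if (i < j)%N then nth 0 (f t) i else nth 0 (g t) (i - j))).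
  by case: (i < j)%N.
by apply/funext => t; rewrite nth_cat sf.
Qed.

Lemma mseq_cst d (T : measurableType d) s : mseq (size s) (fun _ : T => s).
Proof. by split. Qed.

Lemma mseq_comp d d' (T : measurableType d) (T' : measurableType d') k
  (h : T' -> T) (g : T -> seq R) :
  measurable_fun setT h -> mseq k g -> mseq k (fun t => g (h t)).
Proof.
by move=> mh [sg mg]; split => [t|i] //; exact: (measurableT_comp (mg i) mh).
Qed.

Lemma mmap_behead k : mmap k k.-1 behead.
Proof.
move=> d T g [sg mg]; split => [t|i]; first by rewrite size_behead sg.
by rewrite (_ : (fun t => _) = (fun t => nth 0 (g t) i.+1)) //; apply/funext => t; rewrite nth_behead.
Qed.

Lemma mmap_take j k : mmap (j + k) j (take j).
Proof.
move=> d T g [sg mg]; split => [t|i]; first by rewrite size_takel // sg leq_addr.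
rewrite (_ : (fun t => _) = (fun t => if (i < j)%N then nth 0 (g t) i else 0)); first by case: (i < j)%N.
apply/funext => t; case: ltnP => ij; first by rewrite nth_take.
by rewrite nth_default // size_takel // sg leq_addr.
Qed.

Lemma mmap_drop j k : mmap (j + k) k (drop j).
Proof.
move=> d T g [sg mg]; split => [t|i]; first by rewrite size_drop sg addKn.
by rewrite (_ : (fun t => _) = (fun t => nth 0 (g t) (j + i))) //; apply/funext => t; rewrite nth_drop.
Qed.

Lemma mfunl_comp j k F phi : mfunl k F -> mmap j k phi -> mfunl j (fun s => F (phi s)).
Proof. by move=> mF mphi d T g mg; apply: mF; exact: mphi. Qed.

Lemma mfunlM k F G : mfunl k F -> mfunl k G -> mfunl k (fun s => F s * G s)%E.
Proof. by move=> mF mG d T g mg; apply: emeasurable_funM; [exact: mF|exact: mG]. Qed.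

Lemma mfunl_EFin k f : mreal k f -> mfunl k (fun s => (f s)%:E).
Proof. by move=> mf d T g mg; apply/measurable_EFinP; exact: mf. Qed.

Lemma mreal_cst k c : mreal k (fun _ => c).
Proof. by move=> d T g mg; exact: measurable_cst. Qed.

Lemma mreal_nth k i : mreal k (fun s => nth 0 s i).
Proof. by move=> d T g [_ mg]. Qed.

Lemma mreal_comp j k f phi : mreal k f -> mmap j k phi -> mreal j (fun s => f (phi s)).
Proof. by move=> mF mphi d T g mg; apply: mF; exact: mphi. Qed.

Lemma mrealM k f g : mreal k f -> mreal k g -> mreal k (fun s => f s * g s).
Proof. by move=> mf mg d T h mh; apply: measurable_funM; [exact: mf|exact: mg]. Qed.

Lemma mrealD k f g : mreal k f -> mreal k g -> mreal k (fun s => f s + g s).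
Proof. by move=> mf mg d T h mh; apply: measurable_funD; [exact: mf|exact: mg]. Qed.

Lemma mrealB k f g : mreal k f -> mreal k g -> mreal k (fun s => f s - g s).
Proof. by move=> mf mg d T h mh; apply: measurable_funB; [exact: mf|exact: mg]. Qed.

Lemma mrealX k f n : mreal k f -> mreal k (fun s => f s ^+ n).
Proof. by move=> mf d T h mh; apply: measurable_funX; exact: mf. Qed.

Lemma mrealV k f : mreal k f -> mreal k (fun s => (f s)^-1).
Proof. by move=> mf d T h mh; apply: measurable_funV; exact: mf. Qed.

Lemma mreal_norm k f : mreal k f -> mreal k (fun s => `|f s|).
Proof. by move=> mf d T h mh; apply: measurableT_comp => //; exact: mf. Qed.

Lemma mreal_neq0 k f : mreal k f -> mreal k (fun s => (f s != 0)%:R).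
Proof. by move=> mf d T h mh; apply: measurable_neq0; exact: mf. Qed.

Lemma mfunl_cat j F s : mfunl (size s + j) F -> mfunl j (fun u => F (s ++ u)).
Proof.
by move=> mF d T g mg; apply: mF; apply: mseq_cat => //; exact: mseq_cst.
Qed.

Lemma mfunl_cons j F x : mfunl j.+1 F -> mfunl j (fun u => F (x :: u)).
Proof. exact: (@mfunl_cat j F [:: x]). Qed.

Lemma iint_ge0 k (F : seq R -> \bar R) : (forall s, 0 <= F s)%E -> (0 <= iint k F)%E.
Proof.
elim: k F => [|k IH] F F0 //=.
by apply: integral_ge0 => x _; exact: IH.
Qed.

Lemma eq_iint k (F G : seq R -> \bar R) :
  (forall s, size s = k -> F s = G s) -> iint k F = iint k G.
Proof.
elim: k F G => [|k IH] F G FG /=; first exact: FG.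
by apply: eq_integral => x _; apply: IH => s sk; apply: FG; rewrite /= sk.
Qed.

(** Each induction step moves one integration variable into the parameter list [s], hence the
    arbitrary [j]. *)
Lemma measurable_iint j k F : mfunl (j + k) F -> (forall s, 0 <= F s)%E ->
  mfunl j (fun s => iint k (fun u => F (s ++ u))).
Proof.
elim: k j F => [|k IH] j F mF F0 d T g mg /=.
  rewrite (_ : (fun t => _) = (fun t => F (g t))).
    by apply: mF; rewrite addn0.
  by apply/funext => t; rewrite cats0.
apply: (@measurable_fun_fubini_tonelli_F _ _ T mT R leb
  (fun p => iint k (fun u => F (g p.1 ++ p.2 :: u)))) => /=; last first.
  by move=> p; exact: iint_ge0.
have mF' : mfunl (j.+1 + k) F by rewrite addSnnS.
have := IH j.+1 F mF' F0 _ (T * mT)%type (fun p => g p.1 ++ [:: p.2]).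
rewrite (_ : (fun t => _) = (fun p => iint k (fun u => F (g p.1 ++ p.2 :: u)))); last first.
  by apply/funext => p; congr iint; apply/funext => u; rewrite -catA.
apply; rewrite -addn1; apply: mseq_cat; first exact: (mseq_comp measurable_fst).
apply: mseq_cons; first exact: measurable_snd.
exact: mseq_cst.
Qed.

Lemma measurable_iint1 k F : mfunl k.+1 F -> (forall s, 0 <= F s)%E ->
  measurable_fun setT (fun x : mT => iint k (fun u => F (x :: u))).
Proof.
move=> mF F0; apply: (@measurable_iint 1 k F mF F0 _ mT (fun x => [:: x])).
by apply: mseq_cons => //; exact: mseq_cst.
Qed.

Lemma iintZl k (c : R) F : 0 <= c -> mfunl k F -> (forall s, 0 <= F s)%E ->
  (iint k (fun s => c%:E * F s) = c%:E * iint k F)%E.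
Proof.
move=> c0; elim: k F => [|k IH] F mF F0 //=.
rewrite -ge0_integralZl //.
- by apply: eq_integral => x _; apply: IH => //; exact: mfunl_cons.
- exact: measurable_iint1.
- by move=> x _; exact: iint_ge0.
Qed.

Lemma iint_catE a b (F : seq R -> \bar R) :
  iint (a + b) F = iint a (fun s => iint b (fun u => F (s ++ u))).
Proof.
by elim: a F => [|a IH] F //=; apply: eq_integral => x _; exact: IH.
Qed.

Lemma iint_swap k F : mfunl k.+1 F -> (forall s, 0 <= F s)%E ->
  (\int[leb]_x iint k (fun u => F (x :: u)) =
   iint k (fun u => \int[leb]_x F (x :: u)))%E.
Proof.
elim: k F => [|k IH] F mF F0 //=.
rewrite (fubini_tonelli (fun p : mT * mT => iint k (fun u => F (p.1 :: p.2 :: u)))) /=; last 2 first.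
- apply: (@measurable_iint 2 k F mF F0 _ _ (fun p : mT * mT => [:: p.1; p.2])).
  apply: mseq_cons; first exact: measurable_fst.
  apply: mseq_cons; first exact: measurable_snd.
  exact: mseq_cst.
- by move=> p; exact: iint_ge0.
apply: eq_integral => y _.
(* Inserting the fixed [y] in second place presents the remaining integrals as an instance of the
   induction hypothesis. *)
pose phi := fun s : seq R => nth 0 s 0 :: y :: behead s.
have mphi : mmap k.+1 k.+2 phi.
  move=> d T g mg; apply: mseq_cons; first exact: mg.2.
  by apply: mseq_cons => //; exact: (mmap_behead mg).
exact: (IH _ (mfunl_comp mF mphi)).
Qed.

(** The change-of-variables formula itself is taken as the definition, so neither smoothness nor
    injectivity of [phi] appears. The instance [blockmap k id K] expresses that [K] equals 1 almost
    everywhere. *)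
Definition blockmap k (phi : seq R -> seq R) (J : seq R -> R) :=
  [/\ mmap k k phi, mreal k J, (forall s, 0 <= J s) &
   forall F, mfunl k F -> (forall s, 0 <= F s)%E ->
     iint k F = iint k (fun s => (J s)%:E * F (phi s))%E].

Lemma blockmap_comp k phi J psi K : blockmap k phi J -> blockmap k psi K ->
  blockmap k (fun s => phi (psi s)) (fun s => K s * J (psi s)).
Proof.
move=> [mphi mJ J0 HJ] [mpsi mK K0 HK]; split.
- by move=> d T g mg; apply: mphi; exact: mpsi.
- by apply: mrealM => //; exact: (mreal_comp mJ).
- by move=> s; rewrite mulr_ge0.
move=> F mF F0; rewrite HJ // HK //; last 2 first.
- by apply: mfunlM; [exact: mfunl_EFin|exact: (mfunl_comp mF)].
- by move=> s; rewrite mule_ge0 // lee_fin.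
by apply: eq_iint => s _; rewrite EFinM muleA.
Qed.

Fixpoint blocks d (phi : seq R -> seq R) n s : seq R :=
  if n is n'.+1 then phi (take d s) ++ blocks d phi n' (drop d s) else [::].

Fixpoint blocksJ d (J : seq R -> R) n s : R :=
  if n is n'.+1 then J (take d s) * blocksJ d J n' (drop d s) else 1.

Lemma blockmap_blocks d phi J n : blockmap d phi J ->
  blockmap (n * d) (blocks d phi n) (blocksJ d J n).
Proof.
move=> [mphi mJ J0 HJ]; elim: n => [|n [mphin mJn Jn0 HJn]].
  split => [k T g mg|k T g mg|s|F mF F0] //=; last by rewrite mul1e.
rewrite mulSn.
have mb : mmap (d + n * d) (d + n * d) (blocks d phi n.+1).
  move=> k T g mg /=; apply: mseq_cat.
    by apply: mphi; exact: (@mmap_take _ (n * d)).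
  by apply: mphin; exact: (@mmap_drop d).
have mbJ : mreal (d + n * d) (blocksJ d J n.+1).
  apply: mrealM; first by apply: (mreal_comp mJ); exact: mmap_take.
  by apply: (mreal_comp mJn); exact: mmap_drop.
have bJ0 s : 0 <= blocksJ d J n.+1 s by rewrite mulr_ge0.
split => // F mF F0; rewrite !iint_catE.
rewrite HJ; last 2 first.
- exact: measurable_iint.
- by move=> s; exact: iint_ge0.
apply: eq_iint => s ss.
(* The length of [phi s] is obtained by testing [mmap] on a constant family over [unit]. *)
have sp : size (phi s) = d.
  by have [/(_ tt) ->] := @mphi _ unit (fun _ => s) (conj (fun _ => ss) (fun _ => measurable_cst _)).
have mFs : mfunl (n * d) (fun u => F (phi s ++ u)) by apply: mfunl_cat; rewrite sp.
rewrite HJn // -iintZl //; last 2 first.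
- by apply: mfunlM; [exact: mfunl_EFin|exact: (mfunl_comp mFs mphin)].
- by move=> u; rewrite mule_ge0 // lee_fin.
apply: eq_iint => u su /=.
rewrite take_size_cat // drop_size_cat // EFinM.
by rewrite muleA.
Qed.

Definition aff (a b : nat -> R) (s : seq R) : seq R :=
  mkseq (fun i => a i * nth 0 s i + b i) (size s).

Lemma aff_cons a b x s :
  aff a b (x :: s) = (a 0%N * x + b 0%N) :: aff (a \o S) (b \o S) s.
Proof. by rewrite /aff /mkseq /= -(addn0 1%N) iotaDl -map_comp. Qed.

Lemma mmap_aff a b k : mmap k k (aff a b).
Proof.
move=> d T g mg; split => [t|i]; first by rewrite size_mkseq mg.1.
case: (ltnP i k) => ik.
  rewrite (_ : (fun t => _) = (fun t => a i * (nth 0 (g t) i) + b i)).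
    by apply: measurable_funD => //; apply: measurable_funM => //; exact: mg.2.
  by apply/funext => t; rewrite nth_mkseq // mg.1.
rewrite (_ : (fun t => _) = (fun t => 0)) //.
by apply/funext => t; rewrite nth_default // size_mkseq mg.1.
Qed.

Lemma blockmap_aff a b k : (forall i, a i != 0) ->
  blockmap k (aff a b) (fun _ => \prod_(i < k) `|a i|).
Proof.
move=> a0; split; [exact: mmap_aff|exact: mreal_cst|by move=> _; apply: prodr_ge0|].
move=> F mF F0; rewrite iintZl //; last 2 first.
- by apply: prodr_ge0.
- by apply: (mfunl_comp mF); exact: mmap_aff.
elim: k a b a0 F mF F0 => [|k IH] a b a0 F mF F0 /=; first by rewrite big_ord0 mul1e.
rewrite big_ord_recl (@ge0_integral_affine _ (a 0%N) (b 0%N)) //; last 2 first.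
- exact: measurable_iint1.
- by move=> x; exact: iint_ge0.
rewrite EFinM -muleA; congr (_ * _)%E.
have mFF x : mfunl k (fun u => F (a 0%N * x + b 0%N :: u)) by exact: mfunl_cons.
rewrite -ge0_integralZl //; last 3 first.
- apply: (@measurable_iint1 k (fun s => F (aff a b s))) => //.
  by apply: (mfunl_comp mF); exact: mmap_aff.
- by move=> x _; exact: iint_ge0.
- by rewrite lee_fin; apply: prodr_ge0.
apply: eq_integral => x _; rewrite (IH (a \o S) (b \o S)) //; last by move=> i; exact: a0.
by congr (_ * _)%E; apply: eq_iint => s _; rewrite aff_cons.
Qed.

End lists.

(** * Scaling, inversion and rotation of one block *)

Section conformal_blocks.
Variable R : realType.
Local Notation mT := (measurableTypeR R).

Definition nrm2 (s : seq R) : R := \sum_(x <- s) x ^+ 2.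

Lemma nrm2_ge0 s : 0 <= nrm2 s.
Proof. by apply: sumr_ge0 => x _; exact: sqr_ge0. Qed.

Lemma nrm2_cons x s : nrm2 (x :: s) = x ^+ 2 + nrm2 s.
Proof. by rewrite /nrm2 big_cons. Qed.

Lemma nrm2_cons_gt0 x s : x != 0 -> 0 < nrm2 (x :: s).
Proof.
by move=> x0; rewrite nrm2_cons ltr_wpDr ?nrm2_ge0 // exprn_even_gt0.
Qed.

Lemma mreal_nrm2 k : mreal k nrm2.
Proof.
move=> d T g [sg mg].
rewrite (_ : (fun t => _) = (fun t => \sum_(i < k) (nth 0 (g t) i) ^+ 2)).
  by apply: measurable_sum => i; apply: measurable_funX; exact: mg.
by apply/funext => t; rewrite /nrm2 (big_nth 0) big_mkord sg.
Qed.

Definition scale (c : R) (s : seq R) := [seq c * x | x <- s].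

Lemma scaleE c s : scale c s = aff (fun=> c) (fun=> 0) s.
Proof.
elim: s => [|x s IH] //; rewrite aff_cons -[scale c (x :: s)]/(c * x :: scale c s) IH.
by rewrite addr0.
Qed.

Lemma scaleA c c' s : scale c (scale c' s) = scale (c * c') s.
Proof. by rewrite /scale -map_comp; apply: eq_map => x /=; rewrite mulrA. Qed.

Lemma nrm2_scale c s : nrm2 (scale c s) = c ^+ 2 * nrm2 s.
Proof. by rewrite /nrm2 big_map mulr_sumr; apply: eq_bigr => x _; rewrite exprMn. Qed.

Lemma blockmap_scale c k : c != 0 ->
  blockmap k (scale c) (fun=> `|c| ^+ k).
Proof.
move=> c0; have := @blockmap_aff R (fun=> c) (fun=> 0) k (fun=> c0).
rewrite prodr_const card_ord; congr blockmap.
by apply/funext => s; rewrite scaleE.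
Qed.

Lemma mmap_scale j k (f : seq R -> R) phi : mreal j f -> mmap j k phi ->
  mmap j k (fun s => scale (f s) (phi s)).
Proof.
move=> mf mphi d T g mg; have [sp mp] := mphi _ _ _ mg.
split => [t|i]; first by rewrite size_map sp.
rewrite (_ : (fun t => _) = (fun t => f (g t) * nth 0 (phi (g t)) i)).
  by apply: measurable_funM => //; exact: mf.
apply/funext => t; case: (ltnP i k) => ik; first by rewrite (nth_map 0) ?sp.
by rewrite !nth_default ?mulr0 ?size_map ?sp.
Qed.

Lemma mmap_cons j k (f : seq R -> R) phi : mreal j f -> mmap j k phi ->
  mmap j k.+1 (fun s => f s :: phi s).
Proof.
by move=> mf mphi d T g mg; apply: mseq_cons; [exact: mf|exact: mphi].
Qed.

Lemma mmap_id k : mmap k k (@id (seq R)). Proof. by []. Qed.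

Lemma blockmap_neq0 k : blockmap k.+1 id (fun s : seq R => (nth 0 s 0 != 0)%:R).
Proof.
split => [|||F mF F0]; [by []|exact: (mreal_neq0 (@mreal_nth R _ 0))|by []|].
rewrite /= ge0_integral_neq0 //; last 2 first.
- exact: measurable_iint1.
- by move=> x; exact: iint_ge0.
apply: eq_integral => x _; rewrite -iintZl //; exact: mfunl_cons.
Qed.

Definition inv_block (s : seq R) := scale (nrm2 s)^-1 s.

Definition inv_blockJ k (s : seq R) := (nth 0 s 0 != 0)%:R * `|nrm2 s|^-1 ^+ k.

(* Writing x = (t, t u), inversion fixes u and sends t to c/t with
   c = 1/(1 + |u|^2), so only one-dimensional substitutions are needed. *)
Lemma blockmap_inv k : blockmap k.+1 inv_block (inv_blockJ k.+1).
Proof.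
have mh : mreal k.+1 (fun s : seq R => nth 0 s 0) by exact: mreal_nth.
have mJ : mreal k.+1 (inv_blockJ k.+1).
  apply: mrealM; first exact: mreal_neq0.
  by apply: mrealX; apply: mrealV; apply: mreal_norm; exact: mreal_nrm2.
have minv : mmap k.+1 k.+1 inv_block.
  by apply: mmap_scale; [apply: mrealV; exact: mreal_nrm2|exact: mmap_id].
split => // [s|F mF F0].
  by rewrite mulr_ge0 // exprn_ge0 // invr_ge0.
(* [G] is the integrand in the coordinates (t, u) with x = (t, t u); scaling the last k coordinates
   by t costs |t|^k. *)
pose G (s : seq R) := (((nth 0 s 0 != 0)%:R * `|nth 0 s 0| ^+ k)%:E *
  F (nth 0 s 0 :: scale (nth 0 s 0) (behead s))%R)%E.
have mG : mfunl k.+1 G.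
  apply: mfunlM.
    apply: mfunl_EFin; apply: mrealM; first exact: mreal_neq0.
    by apply: mrealX; exact: mreal_norm.
  apply: (mfunl_comp mF); apply: mmap_cons => //.
  by apply: mmap_scale => //; exact: mmap_behead.
have G0 s : (0 <= G s)%E by rewrite mule_ge0 // lee_fin mulr_ge0 // exprn_ge0.
have cgt0 u : 0 < (1 + nrm2 u)^-1.
  by rewrite invr_gt0 ltr_wpDr ?nrm2_ge0.
pose c (s : seq R) := (1 + nrm2 (behead s))^-1.
have mc : mreal k.+1 c.
  apply: mrealV; apply: mrealD; first exact: mreal_cst.
  by apply: (mreal_comp (@mreal_nrm2 k)); exact: mmap_behead.
(* [H] is [G] after t |-> c/t at fixed u, with density |c|/t^2. *)
pose H (s : seq R) := ((`|c s| * `|nth 0 s 0|^-1 ^+ 2)%:E *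
  G (c s / nth 0 s 0 :: behead s)%R)%E.
have mH : mfunl k.+1 H.
  apply: mfunlM.
    apply: mfunl_EFin; apply: mrealM; first exact: mreal_norm.
    by apply: mrealX; apply: mrealV; exact: mreal_norm.
  apply: (mfunl_comp mG); apply: mmap_cons; last exact: mmap_behead.
  by apply: mrealM => //; exact: mrealV.
have H0 s : (0 <= H s)%E.
  by rewrite mule_ge0 // lee_fin mulr_ge0 // exprn_ge0 // invr_ge0.
transitivity (iint k.+1 G).
  have [_ _ _ ->] // := blockmap_neq0 k.
  rewrite /=; apply: eq_integral => t _.
  have [->|t0] := eqVneq t 0.
    by apply: eq_iint => s _; rewrite /G /= eqxx !mul0r !mul0e.
  have [_ _ _ /= HS] := blockmap_scale k t0.
  rewrite (eq_iint (G := fun u => F (t :: u))); last by move=> s _; rewrite mul1e.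
  rewrite HS; last 2 first.
  - exact: mfunl_cons.
  - by [].
  by apply: eq_iint => s _; rewrite /G /= t0 mul1r.
transitivity (iint k.+1 H).
  (* The variable t is outermost but must be substituted at fixed u, so it is moved innermost. *)
  rewrite /= !iint_swap //; apply: eq_iint => u su.
  rewrite (@ge0_integral_inversion _ (1 + nrm2 u)^-1) //.
    by rewrite lt0r_neq0.
  by apply: mG; apply: mseq_cons.
rewrite /=; apply: eq_integral => t _.
have [->|t0] := eqVneq t 0.
  rewrite (eq_iint (G := fun=> 0%E)); last first.
    by move=> s _; rewrite /H /= normr0 invr0 expr0n /= mulr0 mul0e.
  by apply: eq_iint => s _; rewrite /inv_blockJ /= eqxx mul0r mul0e.
(* Return to Cartesian coordinates by u = v/t. With N = |(t, v)|^2 one has c = t^2/N, so the point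
   becomes (t, v)/N and the densities |t|^(-k), |c|/t^2 and |c/t|^k multiply to N^(-(k+1)). *)
have tV0 : t^-1 != 0 by rewrite invr_eq0.
have [_ _ _ /= ->] := blockmap_scale k tV0; last 2 first.
- exact: mfunl_cons.
- by [].
apply: eq_iint => v _.
have N0 := nrm2_cons_gt0 v t0; set N := nrm2 (t :: v) in N0.
have cE : c (t :: scale t^-1 v) = t ^+ 2 / N.
  rewrite /c /= nrm2_scale /N nrm2_cons; field.
  by rewrite t0 andbT -nrm2_cons; exact: lt0r_neq0.
have ctE : c (t :: scale t^-1 v) / t = N^-1 * t.
  by rewrite cE; field; rewrite ?t0 ?lt0r_neq0.
rewrite /H /G /= ctE scaleA cE.
rewrite (_ : N^-1 * t / t = N^-1); last by rewrite mulfK.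
rewrite -[_ :: scale _ _]/(inv_block (t :: v)) !muleA -!EFinM; congr (_%:E * _)%E.
rewrite /inv_blockJ /= -/N t0 mul1r mulf_neq0 ?invr_eq0 ?(lt0r_neq0 N0) // mul1r.
rewrite !normrM !normfV (ger0_norm (ltW N0)) !exprMn !exprVn exprS.
rewrite expr1 [N ^+ k.+1]exprS; field.
by rewrite ?expf_neq0 ?normr_eq0 ?t0 ?lt0r_neq0.
Qed.

(** On the plane of the first two coordinates this is multiplication by a + ib. The other
    coordinates are only dilated; taking c = |a + ib| makes the whole map a similarity. *)
Definition rot_block (a b c : R) (s : seq R) : seq R :=
  [:: a * nth 0 s 0 - b * nth 0 s 1, b * nth 0 s 0 + a * nth 0 s 1 &
      scale c (behead (behead s))].

(** The linear map is factored into substitutions that change one variable at a time. For a = 0 it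
    exchanges the axes up to scaling, hence the separate case. *)
Lemma ge0_integral_rot (a b : R) (K : mT * mT -> \bar R) :
  a ^+ 2 + b ^+ 2 != 0 -> measurable_fun setT K -> (forall p, 0 <= K p)%E ->
  (\int[leb]_x \int[leb]_y K (x, y) = (a ^+ 2 + b ^+ 2)%:E *
   \int[leb]_x \int[leb]_y K (a * x - b * y, b * x + a * y)%R)%E.
Proof.
move=> ab mK K0.
have mKp d (T : measurableType d) (f g : T -> R) : measurable_fun setT f ->
    measurable_fun setT g -> measurable_fun setT (fun t => K (f t, g t)).
  move=> mf mg; apply: (measurableT_comp mK).
  exact: measurable_fun_pair.
have ab0 : 0 <= a ^+ 2 + b ^+ 2 by rewrite addr_ge0 ?sqr_ge0.
have m1 : measurable_fun setT (fst : mT * mT -> R) by exact: measurable_fst.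
have m2 : measurable_fun setT (snd : mT * mT -> R) by exact: measurable_snd.
have mX (f : mT * mT -> \bar R) : measurable_fun setT f -> (forall p, 0 <= f p)%E ->
    measurable_fun setT (fun x => \int[leb]_y f (x, y))%E.
  by move=> mf f0; exact: (@measurable_fun_fubini_tonelli_F _ _ mT mT R leb f).
have [a0|a0] := eqVneq a 0.
  have b0 : b != 0 by apply: contraNneq ab => ->; rewrite a0 expr0n /= addr0.
  have mG := @measurable_fun_fubini_tonelli_G _ _ mT mT R leb K mK K0.
  have G0 y : (0 <= fubini_G leb K y)%E by exact: integral_ge0.
  rewrite (fubini_tonelli K mK K0) (ge0_integral_affine 0 b0 mG G0).
  transitivity (`|b|%:E * \int[leb]_(x in (setT : set mT))
      (`|- b|%:E * \int[leb]_(y in (setT : set mT)) K (- b * y + 0, b * x + 0)%R))%E.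
    congr (_ * _)%E; apply: eq_integral => x _; rewrite /fubini_G.
    rewrite (@ge0_integral_affine _ (- b) 0 (fun z => K (z, b * x + 0))) ?oppr_eq0 //.
    by apply: mKp.
  rewrite ge0_integralZl //; last 2 first.
  - apply: (mX (fun p => K (- b * p.2 + 0, b * p.1 + 0))) => //.
    by apply: mKp; apply: measurable_funD => //; apply: measurable_funM.
  - by move=> x _; exact: integral_ge0.
  rewrite [LHS]muleA; congr (_ * _)%E.
    by rewrite -EFinM normrN -normrM -expr2 a0 expr0n add0r ger0_norm ?sqr_ge0.
  apply: eq_integral => x _; apply: eq_integral => y _; congr K.
  by rewrite a0 !mul0r !addr0 add0r mulNr.
have eN : 0 < a ^+ 2 + b ^+ 2 by rewrite lt0r ab.
rewrite (fubini_tonelli K mK K0).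
(* First x becomes D x - (b/a) v at fixed v, then v becomes a y + b x at fixed x. The value of D is
   the one that turns the first coordinate into a x - b y, and |D| |a| = a^2 + b^2. *)
pose D := (a ^+ 2 + b ^+ 2) / a.
have D0 : D != 0 by rewrite mulf_neq0 ?invr_eq0.
transitivity (`|D|%:E * \int[leb]_(v in (setT : set mT)) \int[leb]_(x in (setT : set mT)) K (D * x + - b / a * v, v)%R)%E.
  rewrite -ge0_integralZl //; last 2 first.
  - apply: (@measurable_fun_fubini_tonelli_G _ _ mT mT R leb (fun p => K (D * p.1 + - b / a * p.2, p.2))) => //=.
    by apply: mKp => //; apply: measurable_funD => //; apply: measurable_funM.
  - by move=> x _; exact: integral_ge0.
  apply: eq_integral => v _.
  by rewrite (@ge0_integral_affine _ D (- b / a * v)) //; exact: mKp.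
rewrite -(fubini_tonelli (fun p : mT * mT => K (D * p.1 + - b / a * p.2, p.2))) //=; last first.
  by apply: mKp => //; apply: measurable_funD => //; apply: measurable_funM.
transitivity (`|D|%:E * \int[leb]_(x in (setT : set mT)) (`|a|%:E *
    \int[leb]_(y in (setT : set mT))
      K (D * x + - b / a * (a * y + b * x), a * y + b * x)%R))%E.
  congr (_ * _)%E; apply: eq_integral => x _.
  rewrite (@ge0_integral_affine _ a (b * x) (fun z => K (D * x + - b / a * z, z))) //.
  by apply: mKp => //; apply: measurable_funD => //; apply: measurable_funM.
rewrite ge0_integralZl //; last 2 first.
- apply: (mX (fun p => K (D * p.1 + - b / a * (a * p.2 + b * p.1), a * p.2 + b * p.1))) => //.
  by apply: mKp; repeat (apply: measurable_funD => // || apply: measurable_funM => //).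
- by move=> x _; exact: integral_ge0.
rewrite [LHS]muleA; congr (_ * _)%E.
  by rewrite -EFinM -normrM /D divfK // ger0_norm.
apply: eq_integral => x _; apply: eq_integral => y _.
by congr K; congr pair; [rewrite /D; field|rewrite addrC].
Qed.

Lemma blockmap_rot (a b c : R) k : a ^+ 2 + b ^+ 2 != 0 -> c != 0 ->
  blockmap k.+2 (rot_block a b c) (fun=> (a ^+ 2 + b ^+ 2) * `|c| ^+ k).
Proof.
move=> ab c0.
have ab0 : 0 <= a ^+ 2 + b ^+ 2 by rewrite addr_ge0 ?sqr_ge0.
have mrot : mmap k.+2 k.+2 (rot_block a b c).
  have mn i : mreal k.+2 (fun s : seq R => nth 0 s i) by exact: mreal_nth.
  have mcn (e : R) i : mreal k.+2 (fun s : seq R => e * nth 0 s i) := mrealM (@mreal_cst _ _ e) (mn i).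
  apply: mmap_cons; first exact: (mrealB (mcn a 0%N) (mcn b 1%N)).
  apply: mmap_cons; first exact: (mrealD (mcn b 0%N) (mcn a 1%N)).
  apply: mmap_scale; first exact: mreal_cst.
  move=> d T g mg; apply: (@mmap_behead _ k.+1); exact: (@mmap_behead _ k.+2).
split; [by []|exact: mreal_cst| |move=> F mF F0 /=].
  by move=> _; rewrite mulr_ge0 // exprn_ge0.
have mFF x y : mfunl k (fun u => F (x :: y :: u)).
  exact: (mfunl_cons y (mfunl_cons x mF)).
pose K := fun p : mT * mT => iint k (fun u => F (p.1 :: p.2 :: u)).
have mK : measurable_fun setT K.
  apply: (@measurable_iint _ 2 k F mF F0 _ _ (fun p : mT * mT => [:: p.1; p.2])).
  apply: mseq_cons; first exact: measurable_fst.
  apply: mseq_cons; first exact: measurable_snd.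
  exact: mseq_cst.
have K0 p : (0 <= K p)%E by exact: iint_ge0.
rewrite -[LHS]/(\int[leb]_x \int[leb]_y K (x, y))%E (@ge0_integral_rot a b) //.
have mKr : measurable_fun setT (fun p : mT * mT => K (a * p.1 - b * p.2, b * p.1 + a * p.2)).
  apply: (measurableT_comp mK).
  by apply: measurable_fun_pair; [apply: measurable_funB|apply: measurable_funD];
    apply: measurable_funM => //; (exact: measurable_fst || exact: measurable_snd).
rewrite -ge0_integralZl //; last 2 first.
- exact: (@measurable_fun_fubini_tonelli_F _ _ mT mT R leb _ mKr).
- by move=> x _; exact: integral_ge0.
apply: eq_integral => x _.
rewrite -ge0_integralZl //; last first.
  have mxy : measurable_fun setT (fun y : mT => (x, y)) by exact: measurable_fun_pair.
  exact: (measurableT_comp mKr mxy).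
apply: eq_integral => y _.
have [_ _ _ HS] := blockmap_scale k c0.
have mS z w : mfunl k (fun u => F (z :: w :: scale c u)).
  apply: (mfunl_comp (mFF z w)).
  by apply: mmap_scale; [exact: mreal_cst|exact: mmap_id].
have ck0 : 0 <= `|c| ^+ k by rewrite exprn_ge0.
have abc0 : 0 <= (a ^+ 2 + b ^+ 2) * `|c| ^+ k by rewrite mulr_ge0.
rewrite /K /= HS // (iintZl ck0 (mS _ _) (fun s => F0 _)).
rewrite muleA -EFinM.
exact: (esym (iintZl abc0 (mS (a * x - b * y) (b * x + a * y)) (fun s => F0 _))).
Qed.

End conformal_blocks.

(** * Edge products, valencies and configurations as lists *)

Section graph_algebra.
Variable R : realType.

(** Positivity of [m] allows passing to logarithms, where the claim is an exchange of the sums over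
    edges and vertices. *)
Lemma prod_valency (G : wgraph R) (m : vertex (nint G) -> R) (c : R) :
  (forall v, 0 < m v) ->
  \prod_(e <- edges G) (m e.1.1 * m e.1.2) `^ (c * e.2) =
  \prod_v m v `^ (c * valency v).
Proof.
move=> m0; have mE v x : m v `^ x = expR (x * ln (m v)) by rewrite /powR gt_eqF.
under eq_bigr do rewrite powRM ?ltW // !mE -expRD.
under [RHS]eq_bigr do rewrite mE.
rewrite -!expR_sum; congr expR.
under [RHS]eq_bigr do rewrite /valency mulr_sumr mulr_suml.
rewrite exchange_big /=; apply: eq_bigr => e _.
rewrite (eq_bigr (fun v => (if e.1.1 == v then c * e.2 * ln (m v) else 0) +
  (if e.1.2 == v then c * e.2 * ln (m v) else 0))).
  rewrite big_split /= -!big_mkcond /=.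
  by rewrite (big_pred1 e.1.1) ?(big_pred1 e.1.2) // => v; rewrite eq_sym.
by move=> v _; do 2 case: ifP => _; ring.
Qed.

Definition dst d (x y : seq R) : R :=
  Num.sqrt (\sum_(i < d) (nth 0 x i - nth 0 y i) ^+ 2).

(* None encodes the point at infinity. *)
Definition odst d (x y : option (seq R)) : R :=
  if x is Some p then if y is Some q then dst d p q else 1 else 1.

Lemma odst_ge0 d x y : 0 <= odst d x y.
Proof. by case: x y => [x|] [y|] //=; exact: sqrtr_ge0. Qed.

Lemma odstC d (x y : option (seq R)) : odst d x y = odst d y x.
Proof.
case: x y => [x|] [y|] //=; congr Num.sqrt.
by apply: eq_bigr => i _; rewrite -sqrrN opprB.
Qed.

(** Writing the dimension as [k.+2] exposes the two coordinates of the plane containing the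
    labels. *)
Definition label_seq k (z : R[i]) (a : label) : option (seq R) :=
  if a == Linf then None
  else if a == L0 then Some (nseq k.+2 0)
  else if a == L1 then Some (1 :: nseq k.+1 0)
  else Some [:: complex.Re z, complex.Im z & nseq k 0].

Definition block d i (s : seq R) := take d (drop (i * d) s).

Definition vertex_seq k n z s (v : vertex n) : option (seq R) :=
  match v with inl a => label_seq k z a | inr i => Some (block k.+2 i s) end.

Lemma nth_nseq0 n i : nth (0 : R) (nseq n 0) i = 0.
Proof. by rewrite nth_nseq if_same. Qed.

Lemma position_vertex_seq k n (z : R[i]) s (v : vertex n) :
  position k.+2 z s v =
  omap (fun x (i : 'I_k.+2) => nth 0 x i) (vertex_seq k z s v).
Proof.
case: v => [a|i] /=; last first.
  by congr Some; apply/funext => j; rewrite /block nth_take // nth_drop.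
rewrite /label_seq; case: ifP => // _; case: ifP => _ /=.
  by congr Some; apply/funext => j; rewrite -[_ :: _]/(nseq k.+2 0) nth_nseq0.
case: ifP => _ /=.
  by congr Some; apply/funext => -[[|j] jk] //=; rewrite -[_ :: _]/(nseq k.+1 0) nth_nseq0.
by congr Some; apply/funext => -[[|[|j]] jk] //=; rewrite nth_nseq0.
Qed.

Lemma edge_factorE k n (z : R[i]) s (e : vertex n * vertex n * R) :
  edge_factor k.+2 z s e =
  odst k.+2 (vertex_seq k z s e.1.1) (vertex_seq k z s e.1.2)
    `^ (- (2 * lambda R k.+2 * e.2)).
Proof.
rewrite /edge_factor !position_vertex_seq.
by case: (vertex_seq _ _ _ _) => [p|] /=; [case: (vertex_seq _ _ _ _) => [q|] /=|]; rewrite ?powR1.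
Qed.

Lemma integrand_conformal k (G : wgraph R) (s : {perm label}) (z z' : R[i])
    (u u' : seq R) (m : vertex (nint G) -> R) :
  (1 <= k)%N -> completed k.+2 G -> (forall v, 0 < m v) ->
  (forall v w, v != w ->
    odst k.+2 (vertex_seq k z u v) (vertex_seq k z u w) =
    odst k.+2 (vertex_seq k z' u' (relabel_vertex s v))
      (vertex_seq k z' u' (relabel_vertex s w)) * (m v * m w)) ->
  integrand k.+2 G z u =
  integrand k.+2 (relabel s G) z' u' * \prod_i (m (inr i) ^+ (2 * k.+2))^-1.
Proof.
move=> k1 [noloop val_int val_lab] m0 h.
rewrite /integrand /= big_map.
transitivity (\prod_(e <- edges G) (edge_factor k.+2 z' u'
    (relabel_vertex s e.1.1, relabel_vertex s e.1.2, e.2) *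
    (m e.1.1 * m e.1.2) `^ (- (2 * lambda R k.+2) * e.2))).
  apply: eq_big_seq => e eG; rewrite !edge_factorE /= h ?noloop //.
  by rewrite powRM ?odst_ge0 // ?mulr_ge0 ?ltW // mulNr.
rewrite big_split /= prod_valency // big_sumType /=; congr (_ * _).
rewrite big1 ?mul1r => [|a _]; last by rewrite val_lab mulr0 powRr0.
apply: eq_bigr => i _; rewrite val_int.
(* Here 2 lambda = k and the valency is 2d/k with d = k + 2, so the exponent is -2d; [1 <= k]
   permits the division. *)
rewrite (_ : - (2 * lambda R k.+2) * _ = - (2 * k.+2)%:R).
  by rewrite powRN powR_mulrn // ltW.
have k0 : k%:R != 0 :> R by rewrite pnatr_eq0 -lt0n.
rewrite /lambda natrM -(addn2 k) natrD addrK; field.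
exact: k0.
Qed.

Lemma blocksJ_prod d (J : seq R -> R) n s :
  blocksJ d J n s = \prod_(i < n) J (block d i s).
Proof.
elim: n s => [|n IH] s /=; first by rewrite big_ord0.
rewrite big_ord_recl /block /= mul0n drop0 IH; congr (_ * _).
by apply: eq_bigr => i _; rewrite /block /= drop_drop /bump /= add1n mulSn addnC.
Qed.

Lemma size_block d n i (s : seq R) : size s = (n * d)%N -> (i < n)%N ->
  size (block d i s) = d.
Proof.
move=> ss ilt; rewrite /block size_takel // size_drop ss -mulnBl.
by rewrite leq_pmull // subn_gt0.
Qed.

Lemma block_blocks d phi n (s : seq R) i :
  (forall x, size x = d -> size (phi x) = d) -> size s = (n * d)%N -> (i < n)%N ->
  block d i (blocks d phi n s) = phi (block d i s).
Proof.
move=> sphi; elim: n s i => [|n IH] s i //= ss.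
have s1 : size (take d s) = d by rewrite size_takel // ss mulSn leq_addr.
have s2 : size (drop d s) = (n * d)%N by rewrite size_drop ss mulSn addKn.
case: i => [_|i ilt].
  by rewrite /block !mul0n !drop0 take_size_cat // sphi.
rewrite /block mulSn addnC -!drop_drop drop_size_cat ?sphi //.
exact: IH.
Qed.

End graph_algebra.

(** * Conformal change of variables in the graphical function *)

Section graphical_functions.
Variable R : realType.

Lemma measurable_position d n j (z : R[i]) (v : vertex n) :
  (forall s, position d z s v = None) \/
  exists p : seq R -> 'I_d -> R,
    (forall i, mreal j (fun s => p s i)) /\ forall s, position d z s v = Some (p s).
Proof.
case: v => [a|i] /=; last first.
  right; exists (fun s (k : 'I_d) => nth 0 s (i * d + k)); split => // k.
  exact: mreal_nth.
have cst (q : 'I_d -> R) : exists p : seq R -> 'I_d -> R,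
    (forall i, mreal j (fun s => p s i)) /\ forall s, Some q = Some (p s).
  by exists (fun=> q); split => // i; exact: mreal_cst.
case: ifP => _; first by left.
by right; case: ifP => _; [exact: cst|case: ifP => _; exact: cst].
Qed.

Lemma measurable_edge_factor d n j (z : R[i]) (e : vertex n * vertex n * R) :
  mreal j (fun s => edge_factor d z s e).
Proof.
rewrite /edge_factor.
have [E1|[p [mp E1]]] := measurable_position d j z e.1.1.
  by under eq_fun do rewrite E1; exact: mreal_cst.
have [E2|[q [mq E2]]] := measurable_position d j z e.1.2.
  by under eq_fun do rewrite E1 E2; exact: mreal_cst.
under eq_fun do rewrite E1 E2 /eucl_dist.
move=> d' T g mg.
pose S t := \sum_(k < d) (p (g t) k - q (g t) k) ^+ 2.
have mS : measurable_fun setT S.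
  apply: measurable_sum => k; apply: measurable_funX; apply: measurable_funB.
    exact: (mp k).
  exact: (mq k).
rewrite (_ : (fun t => _) = (fun t => (S t `^ (2^-1)) `^ (- (2 * lambda R d * e.2)))).
  apply: (measurableT_comp (measurable_powR _)).
  exact: (measurableT_comp (measurable_powR _)).
by apply/funext => t; rewrite powR12_sqrt // sumr_ge0 // => k _; exact: sqr_ge0.
Qed.

Lemma measurable_integrand d j (G : wgraph R) (z : R[i]) :
  mreal j (fun s => integrand d G z s).
Proof.
move=> d' T g mg; rewrite /integrand.
elim: (edges G) => [|e l IH].
  by under eq_fun do rewrite big_nil; exact: measurable_cst.
under eq_fun do rewrite big_cons.
apply: measurable_funM; last exact: IH.
exact: (@measurable_edge_factor d _ j z e _ _ _ mg).
Qed.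

Lemma integrand_ge0 d (G : wgraph R) (z : R[i]) s : 0 <= integrand d G z s.
Proof.
apply: prodr_ge0 => e _; rewrite /edge_factor.
by case: position => [p|] //; case: position => [q|] //; exact: powR_ge0.
Qed.

Lemma mmap_size j k (phi : seq R -> seq R) x :
  mmap j k phi -> size x = j -> size (phi x) = k.
Proof.
move=> mphi sx.
by have [/(_ tt) ->] := @mphi _ unit (fun _ => x) (conj (fun _ => sx) (fun _ => measurable_cst _)).
Qed.

Lemma blocks_id d n (s : seq R) : size s = (n * d)%N -> blocks d id n s = s.
Proof.
elim: n s => [|n IH] s /= ss; first by apply/esym/size0nil.
by rewrite IH ?cat_take_drop // size_drop ss mulSn addKn.
Qed.

(* m_lab and m_int are the square roots of the local scaling factor of the
   conformal map phi, at the labeled and at the unlabeled vertices. *)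
Lemma graphical_function_conformal k (G : wgraph R) (s : {perm label})
    (z z' : R[i]) (phi : seq R -> seq R) (J K : seq R -> R)
    (m_lab : label -> R) (m_int : seq R -> R) :
  (1 <= k)%N -> completed k.+2 G ->
  blockmap k.+2 phi J -> blockmap k.+2 id K ->
  (forall a, 0 < m_lab a) ->
  (forall x, size x = k.+2 -> K x != 0 -> 0 < m_int x) ->
  (forall a b, a != b -> odst k.+2 (label_seq k z a) (label_seq k z b) =
    odst k.+2 (label_seq k z' (s a)) (label_seq k z' (s b)) *
    (m_lab a * m_lab b)) ->
  (forall a x, size x = k.+2 -> K x != 0 ->
    odst k.+2 (label_seq k z a) (Some (phi x)) =
    odst k.+2 (label_seq k z' (s a)) (Some x) * (m_lab a * m_int x)) ->
  (forall x y, size x = k.+2 -> size y = k.+2 -> K x != 0 -> K y != 0 ->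
    dst k.+2 (phi x) (phi y) = dst k.+2 x y * (m_int x * m_int y)) ->
  (forall x, size x = k.+2 -> J x * (m_int x ^+ (2 * k.+2))^-1 = K x) ->
  (forall x, K x = 0 -> J x = 0) ->
  graphical_function k.+2 G z = graphical_function k.+2 (relabel s G) z'.
Proof.
move=> k1 compG bphi bid ml0 mi0 h1 h2 h3 hJ hK.
rewrite /graphical_function /=; congr (_ * _)%E.
set n := nint G.
have [_ _ _ ->] := blockmap_blocks n bphi; last 2 first.
- exact: (mfunl_EFin (@measurable_integrand k.+2 (n * k.+2) G z)).
- by move=> u; rewrite lee_fin integrand_ge0.
have [_ _ _ Hid] := blockmap_blocks n bid; rewrite [RHS]Hid; last 2 first.
- exact: (mfunl_EFin (@measurable_integrand k.+2 (n * k.+2) (relabel s G) z')).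
- by move=> u; rewrite lee_fin integrand_ge0.
apply: eq_iint => u su; rewrite blocks_id // -!EFinM; congr (_%:E).
rewrite !blocksJ_prod.
have sb (i : 'I_n) : size (block k.+2 i u) = k.+2 by exact: size_block su _.
(* If some vertex lies in the excluded null set, both densities contain a zero factor; otherwise the
   pointwise conformal identities apply to every vertex. *)
have [/forallP Ku|/forallPn[i /negPn/eqP Ki0]] :=
    boolP [forall i : 'I_n, K (block k.+2 i u) != 0]; last first.
  by rewrite (bigD1 i) //= [in RHS](bigD1 i) //= Ki0 hK // !mul0r.
pose m (v : vertex n) := match v with
  | inl a => m_lab a | inr i => m_int (block k.+2 i u) end.
have bb (i : 'I_n) : block k.+2 i (blocks k.+2 phi n u) = phi (block k.+2 i u).
  apply: block_blocks => // x sx; case: bphi => mphi _ _ _.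
  exact: (mmap_size mphi).
rewrite (@integrand_conformal _ _ G s z z' (blocks k.+2 phi n u) u m) //.
- rewrite mulrCA -big_split /= mulrC; congr (_ * _).
  by apply: eq_bigr => i _; rewrite hJ.
- by case=> [a|i] //=; exact: mi0.
case=> [a|i] [b|j] vw.
- by apply: h1; apply: contraNneq vw => ->.
- by have := h2 a _ (sb j) (Ku j); rewrite -bb; exact.
- have := h2 b _ (sb i) (Ku i).
  by rewrite -bb [m_lab _ * _]mulrC odstC [in RHS]odstC; exact.
- by have := h3 _ _ (sb i) (sb j) (Ku i) (Ku j); rewrite -!bb; exact.
Qed.

End graphical_functions.

(** * The three transpositions *)

Section transformations.
Variable R : realType.

Lemma label_ind (P : label -> Prop) :
  P L0 -> P L1 -> P Lz -> P Linf -> forall a, P a.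
Proof.
move=> p0 p1 pz pi [[|[|[|[|//]]]] h].
- by rewrite (_ : Ordinal h = L0) //; exact: val_inj.
- by rewrite (_ : Ordinal h = L1) //; exact: val_inj.
- by rewrite (_ : Ordinal h = Lz) //; exact: val_inj.
- by rewrite (_ : Ordinal h = Linf) //; exact: val_inj.
Qed.

Lemma blockmap_id k : blockmap k (@id (seq R)) (fun=> 1).
Proof.
split; [by []|exact: mreal_cst|by []|].
by move=> F _ _; apply: eq_iint => s _; rewrite mul1e.
Qed.

Lemma label_seq_fin k (z : R[i]) a : a != Linf ->
  exists2 q, size q = k.+2 & label_seq k z a = Some q.
Proof.
rewrite /label_seq => /negPf ->.
case: ifP => _; first by exists (nseq k.+2 0) => //; rewrite size_nseq.
case: ifP => _; first by exists (1 :: nseq k.+1 0) => //=; rewrite size_nseq.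
by eexists; last reflexivity; rewrite /= size_nseq.
Qed.

(** The map [phi] carries the relabeled configuration at [z'] back to the original one at [z]. For a
    constant ratio [rho], m is its square root at finite points and the inverse of that root at oo,
    so that an edge to oo keeps the factor 1. *)
Lemma graphical_function_similarity k (G : wgraph R) (s : {perm label})
    (z z' : R[i]) (phi : seq R -> seq R) (J : seq R -> R) (rho : R) :
  (1 <= k)%N -> completed k.+2 G -> blockmap k.+2 phi J -> 0 < rho ->
  (forall x, J x = rho ^+ k.+2) -> s Linf = Linf ->
  (forall a, label_seq k z a = omap phi (label_seq k z' (s a))) ->
  (forall x y, size x = k.+2 -> size y = k.+2 ->
    dst k.+2 (phi x) (phi y) = dst k.+2 x y * rho) ->
  graphical_function k.+2 G z = graphical_function k.+2 (relabel s G) z'.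
Proof.
move=> k1 compG bphi rho0 hJ sinf hlab hdst.
pose r := Num.sqrt rho.
have r0 : 0 < r by rewrite sqrtr_gt0.
have rr : r * r = rho by rewrite -expr2 sqr_sqrtr // ltW.
have rN0 : r != 0 by rewrite gt_eqF.
have sN a : a != Linf -> s a != Linf.
  by apply: contraNneq => sa; apply/eqP; apply: (@perm_inj _ s); rewrite sa sinf.
apply: (@graphical_function_conformal _ k G s z z' phi J (fun=> 1)
  (fun a => if a == Linf then r^-1 else r) (fun=> r) k1 compG bphi
  (@blockmap_id _)).
- by move=> a; case: ifP; rewrite ?invr_gt0.
- by [].
- move=> a b ab.
  have [aE|aN] := eqVneq a Linf.
    have bN : b != Linf by rewrite -aE eq_sym.
    by rewrite aE sinf (negPf bN) /= mulVf // mulr1.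
  have [q sq qE] := label_seq_fin k z' (sN _ aN).
  have [bE|bN] := eqVneq b Linf.
    by rewrite bE sinf odstC [in RHS]odstC /= mulfV // mulr1.
  have [q' sq' qE'] := label_seq_fin k z' (sN _ bN).
  by rewrite !hlab qE qE' /= hdst // rr.
- move=> a x sx _; have [aE|aN] := eqVneq a Linf.
    by rewrite aE sinf /= mulVf // mulr1.
  have [q sq qE] := label_seq_fin k z' (sN _ aN).
  by rewrite hlab qE /= hdst // rr.
- by move=> x y sx sy _ _; rewrite hdst // rr.
- by move=> x sx; rewrite hJ exprM expr2 rr mulfV // expf_neq0 // gt_eqF.
- by move=> x /eqP; rewrite oner_eq0.
Qed.

Lemma aff_nseq0 (a b : nat -> R) k : (forall i, b i = 0) ->
  aff a b (nseq k 0) = nseq k 0.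
Proof.
elim: k a b => [|k IH] a b b0 //=; rewrite aff_cons mulr0 b0 addr0 IH //.
by move=> i; exact: b0.
Qed.

Lemma nth_aff (a b : nat -> R) s i : (i < size s)%N ->
  nth 0 (aff a b s) i = a i * nth 0 s i + b i.
Proof. by move=> si; rewrite nth_mkseq. Qed.

Lemma nth_scale (c : R) s i : nth 0 (scale c s) i = c * nth 0 s i.
Proof.
have [si|si] := ltnP i (size s); first by rewrite (nth_map 0).
by rewrite !nth_default ?mulr0 ?size_map.
Qed.

Lemma scale_nseq0 (c : R) k : scale c (nseq k 0) = nseq k 0.
Proof. by rewrite /scale map_nseq mulr0. Qed.

Lemma graphical_function_01 k (G : wgraph R) (z : R[i]) :
  (1 <= k)%N -> completed k.+2 G ->
  graphical_function k.+2 G z =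
  graphical_function k.+2 (relabel (tperm L0 L1) G) (1 - z).
Proof.
move=> k1 compG; pose e i : R := (i == 0%N)%:R.
have N1 : (-1 : R) != 0 by rewrite oppr_eq0 oner_eq0.
apply: (@graphical_function_similarity k G (tperm L0 L1) z (1 - z) _ _ 1 k1 compG
  (@blockmap_aff R (fun=> -1) e k.+2 (fun=> N1))) => //.
- by move=> x; rewrite expr1n big1 // => i _; rewrite normrN1.
- by rewrite tpermD.
- case: z => a b; elim/label_ind.
  + rewrite tpermL /label_seq /=; congr Some.
    by rewrite !aff_cons aff_nseq0 // /e /= !(mulr0, mulN1r, addr0, addNr).
  + rewrite tpermR /label_seq /=; congr Some.
    by rewrite !aff_cons aff_nseq0 // /e /= !(mulr0, add0r, addr0).
  + rewrite tpermD // /label_seq /=; congr Some.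
    rewrite !aff_cons aff_nseq0 // /e /=.
    by congr [:: _, _ & _]; ring.
  + by rewrite tpermD.
- move=> x y sx sy; rewrite mulr1; congr Num.sqrt.
  apply: eq_bigr => i _; rewrite !nth_aff ?sx ?sy //; ring.
Qed.

Lemma sum_sqr_neq0 (z : R[i]) : z != 0 ->
  complex.Re z ^+ 2 + complex.Im z ^+ 2 != 0.
Proof.
case: z => a b; rewrite eq_complex /= => ab.
by rewrite paddr_eq0 ?sqr_ge0 // !sqrf_eq0.
Qed.

(** Multiplication by z fixes 0 and sends 1 to z and 1/z to 1, so it carries the relabeled
    configuration at 1/z to the original one. *)
Lemma graphical_function_1z k (G : wgraph R) (z : R[i]) :
  (1 <= k)%N -> completed k.+2 G -> z != 0 ->
  graphical_function k.+2 G z =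
  graphical_function k.+2 (relabel (tperm L1 Lz) G) z^-1.
Proof.
move=> k1 compG /sum_sqr_neq0; case: z => a b /= N0.
have Nge0 : 0 <= a ^+ 2 + b ^+ 2 by rewrite addr_ge0 ?sqr_ge0.
have Ngt0 : 0 < a ^+ 2 + b ^+ 2 by rewrite lt0r N0.
pose rho := Num.sqrt (a ^+ 2 + b ^+ 2).
have rho0 : 0 < rho by rewrite sqrtr_gt0.
have rhoN0 : rho != 0 by rewrite gt_eqF.
have rho2 : rho ^+ 2 = a ^+ 2 + b ^+ 2 by rewrite sqr_sqrtr.
apply: (@graphical_function_similarity k G (tperm L1 Lz) (Complex a b)
  (Complex a b)^-1 _ _ rho k1 compG (blockmap_rot k N0 rhoN0)) => //.
- by move=> x; rewrite -rho2 gtr0_norm // -exprD.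
- by rewrite tpermD.
- elim/label_ind.
  + rewrite tpermD // /label_seq /= /rot_block /= scale_nseq0.
    by rewrite !mulr0 subr0 addr0.
  + rewrite tpermL /label_seq /= /rot_block /= scale_nseq0.
    by congr (Some [:: _, _ & _]); field.
  + rewrite tpermR /label_seq /= /rot_block /= scale_nseq0.
    by congr (Some [:: _, _ & _]); ring.
  + by rewrite tpermD.
- have rhoE : rho = Num.sqrt (rho ^+ 2) by rewrite sqrtr_sqr gtr0_norm.
  move=> x y sx sy; rewrite [X in _ = _ * X]rhoE /dst -sqrtrM; last first.
    by apply: sumr_ge0 => i _; exact: sqr_ge0.
  congr Num.sqrt; rewrite !big_ord_recl /= /bump /= !add1n.
  rewrite !mulrDl mulr_suml !addrA; congr (_ + _); first by rewrite rho2; ring.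
  by apply: eq_bigr => i _; rewrite !nth_scale !nth_behead !add0n -mulrBr exprMn mulrC.
Qed.

Lemma nrm2E k (x : seq R) : size x = k -> nrm2 x = \sum_(i < k) nth 0 x i ^+ 2.
Proof. by move=> <-; rewrite /nrm2 (big_nth 0) big_mkord. Qed.

Lemma nrm2_nseq0 k : nrm2 (nseq k 0) = 0 :> R.
Proof. by rewrite /nrm2 big_nseq iter_addr addr0 expr0n mul0rn. Qed.

Definition conj_sign (i : nat) : R := if i == 1%N then -1 else 1.

(* The inversion x / |x|^2 followed by the reflection of the second
   coordinate: on the plane of the labels this is w |-> 1/w. *)
Definition conj_inv (x : seq R) : seq R := aff conj_sign (fun=> 0) (inv_block x).

Lemma conj_sign_sqr i : conj_sign i ^+ 2 = 1.
Proof. by rewrite /conj_sign; case: ifP; rewrite ?sqrrN expr1n. Qed.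

Lemma size_inv_block (x : seq R) : size (inv_block x) = size x.
Proof. by rewrite size_map. Qed.

Lemma nth_conj_inv (x : seq R) i : (i < size x)%N ->
  nth 0 (conj_inv x) i = conj_sign i * ((nrm2 x)^-1 * nth 0 x i).
Proof. by move=> si; rewrite nth_aff ?size_inv_block // addr0 nth_scale. Qed.

Lemma size_conj_inv (x : seq R) : size (conj_inv x) = size x.
Proof. by rewrite size_mkseq size_inv_block. Qed.

(** The signs drop out of the squares; expanding both squared distances leaves a rational identity
    in |x|^2, |y|^2 and the inner product of x and y. *)
Lemma dst_conj_inv k (x y : seq R) : size x = k -> size y = k ->
  nrm2 x != 0 -> nrm2 y != 0 ->
  dst k (conj_inv x) (conj_inv y) =
  dst k x y * ((Num.sqrt (nrm2 x))^-1 * (Num.sqrt (nrm2 y))^-1).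
Proof.
move=> sx sy x0 y0; rewrite -!sqrtrV ?nrm2_ge0 //.
have s0 : 0 <= \sum_(i < k) (nth 0 x i - nth 0 y i) ^+ 2.
  by apply: sumr_ge0 => i _; exact: sqr_ge0.
rewrite /dst -sqrtrM ?invr_ge0 ?nrm2_ge0 // -sqrtrM //; congr Num.sqrt.
have E (c d : R) : \sum_(i < k) (c * nth 0 x i - d * nth 0 y i) ^+ 2 =
    c ^+ 2 * nrm2 x + d ^+ 2 * nrm2 y - 2 * c * d * \sum_(i < k) nth 0 x i * nth 0 y i.
  rewrite (nrm2E sx) (nrm2E sy) !mulr_sumr -big_split -sumrB /=.
  by apply: eq_bigr => i _; ring.
have := E 1 1; under eq_bigr do rewrite !mul1r; move=> ->.
transitivity (\sum_(i < k) ((nrm2 x)^-1 * nth 0 x i - (nrm2 y)^-1 * nth 0 y i) ^+ 2).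
  apply: eq_bigr => i _; rewrite !nth_conj_inv ?sx ?sy // -mulrBr exprMn.
  by rewrite conj_sign_sqr mul1r.
by rewrite E; field; rewrite x0 y0.
Qed.

Lemma dst0 k (x : seq R) : size x = k -> dst k (nseq k 0) x = Num.sqrt (nrm2 x).
Proof.
move=> sx; rewrite (nrm2E sx); congr Num.sqrt; apply: eq_bigr => i _.
by rewrite nth_nseq0 add0r sqrrN.
Qed.

Lemma nrm2_conj_inv (x : seq R) : nrm2 (conj_inv x) = (nrm2 x)^-1.
Proof.
rewrite (nrm2E (size_conj_inv x)).
under eq_bigr do rewrite nth_conj_inv // !exprMn conj_sign_sqr mul1r.
rewrite -mulr_sumr -(nrm2E erefl).
have [->|x0] := eqVneq (nrm2 x) 0; first by rewrite invr0 mulr0.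
by field.
Qed.

Lemma conj_inv_complex k (z : R[i]) (q := [:: complex.Re z^-1, complex.Im z^-1 & nseq k 0]) :
  z != 0 -> nrm2 q != 0 /\ conj_inv q = [:: complex.Re z, complex.Im z & nseq k 0].
Proof.
move=> /sum_sqr_neq0; rewrite {}/q; case: z => a b /= N0.
have nE : nrm2 [:: a / (a ^+ 2 + b ^+ 2), - (b / (a ^+ 2 + b ^+ 2)) & nseq k 0] =
    (a ^+ 2 + b ^+ 2)^-1.
  by rewrite !nrm2_cons nrm2_nseq0; field.
split; first by rewrite nE invr_eq0.
rewrite /conj_inv /inv_block nE invrK /scale /= map_nseq mulr0 !aff_cons aff_nseq0 //.
by rewrite /conj_sign /=; congr [:: _, _ & _]; field.
Qed.

Lemma graphical_function_0inf k (G : wgraph R) (z : R[i]) :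
  (1 <= k)%N -> completed k.+2 G -> z != 0 ->
  graphical_function k.+2 G z =
  graphical_function k.+2 (relabel (tperm L0 Linf) G) z^-1.
Proof.
move=> k1 compG z0.
have sgn0 i : conj_sign i != 0.
  by apply/eqP => h; have := conj_sign_sqr i; rewrite h expr0n => /eqP; rewrite eq_sym oner_eq0.
have sgn1 i : `|conj_sign i| = 1.
  by rewrite /conj_sign; case: ifP; rewrite ?normrN1 ?normr1.
pose t := tperm L0 Linf.
pose w (q : seq R) := (Num.sqrt (nrm2 q))^-1.
(* The factor is 1/|q| at a nonzero finite point q. At 0 and oo the value 1 is right: the image of x
   has distance 1/|x| = w(x) from 0, and |x| w(x) = 1 is the formal distance to oo. *)
pose ml a := if label_seq k z^-1 (t a) is Some q then
  if nrm2 q == 0 then 1 else w q else 1.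
have w0 q : nrm2 q != 0 -> 0 < w q.
  by move=> q0; rewrite invr_gt0 sqrtr_gt0 lt0r q0 nrm2_ge0.
have ww q : nrm2 q != 0 -> Num.sqrt (nrm2 q) * w q = 1.
  by move=> q0; rewrite mulfV // -invr_eq0 gt_eqF // w0.
have t0 : t L0 = Linf by rewrite /t tpermL.
have ti : t Linf = L0 by rewrite /t tpermR.
have ml0 : ml L0 = 1 by rewrite /ml t0.
have mli : ml Linf = 1 by rewrite /ml ti /label_seq /= -[0 :: _]/(nseq k.+2 0) nrm2_nseq0 eqxx.
(* Only the labels 1 and z occupy finite nonzero points, where the inversion identity applies
   directly; 0 and oo are treated by hand. *)
have hlab a : [\/ a = L0, a = Linf | exists q, [/\ size q = k.+2, nrm2 q != 0,
    label_seq k z^-1 (t a) = Some q, label_seq k z a = Some (conj_inv q) &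
    ml a = w q]].
  elim/label_ind: a; [by constructor 1| | |by constructor 2]; constructor 3.
    have n1 : nrm2 (1 :: nseq k.+1 0) = 1 :> R.
      by rewrite nrm2_cons nrm2_nseq0 addr0 expr1n.
    exists (1 :: nseq k.+1 0); rewrite n1 oner_neq0 /ml tpermD //; split => //.
    - by rewrite /= size_nseq.
    - rewrite /label_seq /=; congr Some.
      rewrite /conj_inv /inv_block n1 invr1 -[1 :: _]/(1 :: nseq k.+1 0).
      by rewrite /scale /= map_nseq mulr0 !aff_cons aff_nseq0 // /conj_sign /= !(mulr0, mulr1, addr0).
    - by rewrite /label_seq /= n1 oner_eq0.
  have [qn qE] := conj_inv_complex k z0; eexists; split; [|exact: qn| | |].
  - by rewrite /= size_nseq.
  - by rewrite tpermD.
  - by rewrite qE.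
  - by rewrite /ml tpermD // /label_seq /= (negPf qn).
have K0 (x : seq R) : size x = k.+2 -> ((nth 0 x 0 != 0)%:R : R) != 0 -> nrm2 x != 0.
  case: x => // a x _ /=; have [->|a0 _] := eqVneq a 0; first by rewrite eqxx.
  by rewrite lt0r_neq0 // nrm2_cons_gt0.
have F1 x : size x = k.+2 -> dst k.+2 (nseq k.+2 0) (conj_inv x) = w x.
  by move=> sx; rewrite dst0 ?size_conj_inv // nrm2_conj_inv sqrtrV ?nrm2_ge0.
have S0 (a : R[i]) : label_seq k a L0 = Some (nseq k.+2 0) by [].
have Si (a : R[i]) : label_seq k a Linf = None by [].
have h2 a x : size x = k.+2 -> nrm2 x != 0 ->
    odst k.+2 (label_seq k z a) (Some (conj_inv x)) =
    odst k.+2 (label_seq k z^-1 (t a)) (Some x) * (ml a * w x).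
  move=> sx x0; have [->|->|[q [sq q0 -> -> ->]]] := hlab a.
  - by rewrite t0 S0 Si ml0 /odst F1 // !mul1r.
  - by rewrite ti S0 Si mli /odst dst0 // mul1r ww.
  - by rewrite /odst dst_conj_inv.
have ml_gt0 a : 0 < ml a.
  have [->|->|[q [_ q0 _ _ ->]]] := hlab a; rewrite ?ml0 ?mli //.
  exact: w0.
(* The density is that of inversion, the reflection contributing 1. [K] is the indicator of a
   nonzero first coordinate, which in particular keeps x away from the origin. *)
refine (@graphical_function_conformal _ k G t z z^-1 _ _
  (fun x => (nth 0 x 0 != 0)%:R) ml w k1 compG
  (blockmap_comp (@blockmap_aff R (@conj_sign) (fun=> 0) k.+2 sgn0) (blockmap_inv R k.+1))
  (@blockmap_neq0 R k.+1) ml_gt0 _ _ _ _ _ _).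
- by move=> x sx x0; apply: w0; exact: K0.
- move=> a b ab.
  have [bE|bE|[q [sq q0 qE qE' mE]]] := hlab b; last first.
  + by rewrite qE qE' mE h2.
  + have [aE|aE|[q [sq q0 qE qE' mE]]] := hlab a.
    * by rewrite aE bE t0 ti ml0 mli S0 Si /odst !mulr1.
    * by move: ab; rewrite aE bE eqxx.
    * by rewrite odstC [in RHS]odstC [ml a * _]mulrC qE qE' mE h2.
  + have [aE|aE|[q [sq q0 qE qE' mE]]] := hlab a.
    * by move: ab; rewrite aE bE eqxx.
    * by rewrite aE bE t0 ti ml0 mli S0 Si /odst !mulr1.
    * by rewrite odstC [in RHS]odstC [ml a * _]mulrC qE qE' mE h2.
- by move=> a x sx x0; apply: h2 => //; exact: K0.
- by move=> x y sx sy x0 y0; apply: dst_conj_inv => //; exact: K0.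
- move=> x sx; rewrite big1 ?mulr1; last by move=> i _; exact: sgn1.
  rewrite /inv_blockJ; have [x0|x0] := eqVneq (nth 0 x 0) 0.
    by rewrite !mul0r.
  have nx : nrm2 x != 0 by apply: K0; rewrite // x0 oner_neq0.
  rewrite mul1r /w !exprVn invrK exprM sqr_sqrtr ?nrm2_ge0 //.
  by rewrite ger0_norm ?nrm2_ge0 // mulVf // expf_neq0.
- by move=> x x0; rewrite /inv_blockJ x0 !mul0r.
Qed.

End transformations.

(** * The action on the cross-ratio *)

Section moebius.
Variable F : fieldType.
Implicit Types (B : label -> label -> F) (z w : F) (s t : {perm label}).

(** Homogeneous coordinates on the projective line, so that oo needs no special treatment in the
    brackets. *)
Definition homog z (a : label) : F * F :=
  if a == L0 then (0, 1) else if a == L1 then (1, 1)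
  else if a == Lz then (z, 1) else (1, 0).

Definition bracket (p q : F * F) : F := p.1 * q.2 - q.1 * p.2.

Definition cross_ratio B (a b c e : label) : F := (B a b * B c e) / (B a e * B c b).

(** After relabeling by s, label a sits at the point formerly labeled s^(-1)(a). The cross-ratio is
    normalised to return z on the points 0, 1, z, oo, so this is the position of the new label z
    once the new 0, 1, oo are brought to standard position. *)
Definition moebius s z : F :=
  cross_ratio (fun a b => bracket (homog z (s^-1%g a)) (homog z (s^-1%g b)))
    Lz L0 L1 Linf.

Lemma bracket_neq0 z a b : z != 0 -> z != 1 -> a != b ->
  bracket (homog z a) (homog z b) != 0.
Proof.
move=> z0 z1; elim/label_ind: a; elim/label_ind: b => //= _;
  rewrite /bracket /homog /= !(mul0r, mulr0, mul1r, mulr1, subr0, sub0r, oppr_eq0) ?oner_neq0 //.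
all: by rewrite subr_eq0 // eq_sym.
Qed.

(** Every label occurs once above and once below the fraction bar, so its factor [c] cancels, and so
    do the two copies of [D]. *)
Lemma cross_ratio_scale B B' (c : label -> F) (D : F) a b e f :
  D != 0 -> (forall a, c a != 0) -> (forall a b, B a b = c a * c b * D * B' a b) ->
  cross_ratio B a b e f = cross_ratio B' a b e f.
Proof.
move=> D0 c0 BE; rewrite /cross_ratio !BE.
set k := c a * c b * c e * c f * D * D.
have k0 : k != 0 by rewrite !mulf_neq0.
have kE u v x y : c a * u * D * x * (c e * v * D * y) = c a * c e * D * D * u * v * (x * y).
  by ring.
rewrite !kE -[_ * c f * c b]mulrAC.
rewrite (_ : c a * c e * D * D * c b * c f = k); last by rewrite /k; ring.
by rewrite invfM mulrACA mulfV // mul1r.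
Qed.

(* Four points of the projective line in general position are, up to a
   projectivity and rescaling, the points 0, 1, w, oo with w their cross-ratio;
   the factors below are read off the brackets with oo and the Pluecker
   relation. *)
Lemma bracket_normal_form (X : label -> F * F)
    (B := fun a b => bracket (X a) (X b)) (w := cross_ratio B Lz L0 L1 Linf) :
  (forall a b, a != b -> B a b != 0) ->
  exists c : label -> F, exists D : F, [/\ D != 0, (forall a, c a != 0) &
    forall a b, B a b = c a * c b * D * bracket (homog w a) (homog w b)].
Proof.
move=> B0.
have Bii a : B a a = 0 by rewrite /B /bracket subrr.
have Bsym a b : B a b = - B b a by rewrite /B /bracket opprB.
have pluecker : B Lz L1 * B L0 Linf = B Lz L0 * B L1 Linf - B Lz Linf * B L1 L0.
  by rewrite /B /bracket; ring.
have z0 : B Lz L0 != 0 by exact: B0.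
have zi : B Lz Linf != 0 by exact: B0.
have oi : B L1 Linf != 0 by exact: B0.
have oo : B L1 L0 != 0 by exact: B0.
have ni : B L0 Linf != 0 by exact: B0.
have z1 : B Lz L1 = (B Lz L0 * B L1 Linf - B Lz Linf * B L1 L0) / B L0 Linf.
  by rewrite -pluecker mulfK.
(* Normalise c(oo) = 1. In the model every finite point has bracket -1 with oo, which forces c(a) =
   - B(a, oo)/D; the pair (1, 0), of bracket 1, then determines D. *)
pose D := B L1 Linf * B L0 Linf / B L1 L0.
have D0 : D != 0 by rewrite !mulf_neq0 ?invr_eq0.
exists (fun a => if a == Linf then 1 else - B a Linf / D), D; split => //.
  move=> a; case: ifP => [_|/negbT ai]; first exact: oner_neq0.
  by rewrite mulf_neq0 ?invr_eq0 // oppr_eq0 B0.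
elim/label_ind => [] ; elim/label_ind;
  rewrite /w /cross_ratio /D /bracket /homog /= ?Bii ?(Bsym L0 L1) ?(Bsym L0 Lz)
    ?(Bsym L1 Lz) ?(Bsym Linf L0) ?(Bsym Linf L1) ?(Bsym Linf Lz) ?z1; field;
  rewrite ?z0 ?zi ?oi ?oo ?ni //.
Qed.

(** The points relabeled by s have, up to rescaling, the brackets of the standard points with w =
    [moebius s z]. Relabeling both by t gives equal cross-ratios. The product applies s first. *)
Lemma moebiusM s t z : z != 0 -> z != 1 ->
  moebius (s * t)%g z = moebius t (moebius s z).
Proof.
move=> z0 z1.
have [|c [D [D0 c0 BE]]] := @bracket_normal_form (fun a => homog z (s^-1%g a)).
  by move=> a b ab; apply: bracket_neq0 => //; rewrite (inj_eq perm_inj).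
rewrite {1}/moebius invMg.
rewrite -[RHS](@cross_ratio_scale (fun a b => bracket (homog z ((t^-1 * s^-1)%g a))
  (homog z ((t^-1 * s^-1)%g b))) _ (fun a => c (t^-1%g a)) D) // => a b.
by rewrite !permM BE.
Qed.

Lemma moebius1 z : moebius 1%g z = z.
Proof.
rewrite /moebius /cross_ratio invg1 !perm1 /bracket /homog /=.
by field; rewrite ?oppr_eq0 ?oner_neq0.
Qed.

Lemma moebius_0inf z : moebius (tperm L0 Linf) z = z^-1.
Proof.
rewrite /moebius /cross_ratio tpermV tpermL tpermR !tpermD // /bracket /homog /=.
by rewrite !(mul0r, mulr0, mul1r, mulr1, subr0, sub0r) mulrN1 invrN mulrNN mul1r.
Qed.

Lemma moebius_1z z : moebius (tperm L1 Lz) z = z^-1.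
Proof.
rewrite /moebius /cross_ratio tpermV tpermL tpermR !tpermD // /bracket /homog /=.
by rewrite !(mul0r, mulr0, mul1r, mulr1, subr0, sub0r) !mulN1r invrN opprK.
Qed.

Lemma moebius_01 z : moebius (tperm L0 L1) z = 1 - z.
Proof.
rewrite /moebius /cross_ratio tpermV tpermL tpermR !tpermD // /bracket /homog /=.
by field; rewrite ?oppr_eq0 ?oner_neq0.
Qed.

End moebius.

(** * Relabeling as a group action and generation by transpositions *)

Section relabeling.
Variable R : realType.
Implicit Types (G : wgraph R) (s t : {perm label}).

Lemma relabel_vertexM n s t (v : vertex n) :
  relabel_vertex t (relabel_vertex s v) = relabel_vertex (s * t)%g v.
Proof. by case: v => [a|i] //=; rewrite permM. Qed.

Lemma relabel_vertex1 n (v : vertex n) : relabel_vertex 1%g v = v.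
Proof. by case: v => [a|i] //=; rewrite perm1. Qed.

Lemma relabelM s t G : relabel t (relabel s G) = relabel (s * t)%g G.
Proof.
rewrite /relabel /= -map_comp; congr WGraph; apply: eq_map => e /=.
by rewrite !relabel_vertexM.
Qed.

Lemma relabel1 G : relabel 1%g G = G.
Proof.
case: G => n l; rewrite /relabel /=; congr WGraph.
rewrite -[RHS]map_id; apply: eq_map => -[[u v] x] /=.
by rewrite !relabel_vertex1.
Qed.

Lemma relabel_vertex_inj n s : injective (@relabel_vertex n s).
Proof.
apply: (@can_inj _ _ _ (relabel_vertex s^-1%g)) => v.
by rewrite relabel_vertexM mulgV relabel_vertex1.
Qed.

Lemma valency_relabel s G (v : vertex (nint G)) :
  @valency R (relabel s G) (relabel_vertex s v) = valency v.
Proof.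
rewrite /valency /= big_map; apply: eq_bigr => e _ /=.
by rewrite !(inj_eq (@relabel_vertex_inj _ s)).
Qed.

Lemma completed_relabel d s G : completed d G -> completed d (relabel s G).
Proof.
move=> [noloop vint vlab]; split.
- move=> _ /mapP[e eG ->] /=; rewrite (inj_eq (@relabel_vertex_inj _ s)).
  exact: noloop.
- move=> i; have := valency_relabel s (inr i : vertex (nint G)). by rewrite vint.
- move=> a; have := valency_relabel s (inl (s^-1%g a) : vertex (nint G)).
  by rewrite /= permKV vlab.
Qed.

(** The permutations satisfying [P] form a subgroup, and the transpositions (0 y) generate the
    symmetric group. *)
Lemma perm_label_ind (P : {perm label} -> Prop) :
  P 1%g -> (forall s t, P s -> P t -> P (s * t)%g) ->
  P (tperm L0 Linf) -> P (tperm L0 L1) -> P (tperm L1 Lz) -> forall s, P s.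
Proof.
move=> P1 PM Pi P01 P1z s.
pose H := [set t | `[< P t >]]%SET.
have HP t : (t \in H) = `[< P t >] by rewrite inE.
have gH : group_set H.
  apply/group_setP; split => [|x y]; rewrite !HP; first exact/asboolP.
  by move=> /asboolP Px /asboolP Py; apply/asboolP; exact: PM.
suff /fintype.subsetP/(_ s) : [set: {perm label}]%SET \subset Group gH.
  by rewrite inE HP => /(_ isT)/asboolP.
rewrite -(gen_tperm L0) gen_subG; apply/fintype.subsetP => _ /imsetP[y _ ->].
rewrite HP; apply/asboolP; elim/label_ind: y => //.
  by rewrite tperm1.
(* The missing transposition (0 z) is the conjugate of (0 1) by (1 z). *)
rewrite (_ : tperm L0 Lz = (tperm L1 Lz * (tperm L0 L1 * tperm L1 Lz))%g).
  by apply: (PM) => //; exact: PM.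
by rewrite -[X in _ = (X * _)%g]tpermV -/(conjg _ _) tpermJ tpermD // tpermL.
Qed.

End relabeling.

Theorem mainTheorem11 (R : realType) (d : nat) (G : wgraph R) :
  (3 <= d)%N -> completed d G -> gf_converges d G ->
  (forall z : R[i], z != 0 -> z != 1 ->
     [/\ graphical_function d G z
           = graphical_function d (relabel (tperm L0 Linf) G) z^-1,
         graphical_function d G z
           = graphical_function d (relabel (tperm L0 L1) G) (1 - z) &
         graphical_function d G z
           = graphical_function d (relabel (tperm L1 Lz) G) z^-1]) /\
  (exists phi : {perm label} -> R[i] -> R[i],
     [/\ (forall (s t : {perm label}) (z : R[i]), z != 0 -> z != 1 ->
            phi (s * t)%g z = phi t (phi s z)),
         (forall z : R[i], z != 0 -> z != 1 -> phi (tperm L0 Linf) z = z^-1),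
         (forall z : R[i], z != 0 -> z != 1 -> phi (tperm L1 Lz) z = z^-1),
         (forall z : R[i], z != 0 -> z != 1 -> phi (tperm L0 L1) z = 1 - z) &
         (forall (s : {perm label}) (z : R[i]), z != 0 -> z != 1 ->
            graphical_function d G z = graphical_function d (relabel s G) (phi s z))]).
Proof.
case: d => [|[|k]] // k1 compG _.
split=> [z z0 z1|].
  by split; [exact: graphical_function_0inf|exact: graphical_function_01|
    exact: graphical_function_1z].
exists (@moebius R[i]); split.
- by move=> s t z; exact: moebiusM.
- by move=> z _ _; exact: moebius_0inf.
- by move=> z _ _; exact: moebius_1z.
- by move=> z _ _; exact: moebius_01.
have V0 (z : R[i]) : z != 0 -> z != 1 -> z^-1 != 0 /\ z^-1 != 1.
  by move=> z0 z1; rewrite invr_eq0 invr_eq1.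
(* The graph and z are generalised because the second factor of a product acts on the relabeled
   graph at the transformed point; that point must again avoid 0 and 1, so this is proved
   simultaneously. *)
suff H s (G' : wgraph R) (z : R[i]) : completed k.+2 G' -> z != 0 -> z != 1 ->
    graphical_function k.+2 G' z =
      graphical_function k.+2 (relabel s G') (moebius s z) /\
    (moebius s z != 0 /\ moebius s z != 1).
  by move=> s z z0 z1; have [] := H s G z compG z0 z1.
elim/perm_label_ind: s G' z => [|s t Hs Ht|||] {compG} G' z compG z0 z1.
- by rewrite relabel1 moebius1.
- have [-> [w0 w1]] := Hs _ _ compG z0 z1.
  have [-> w01] := Ht _ _ (completed_relabel s compG) w0 w1.
  by rewrite relabelM moebiusM.
- by rewrite moebius_0inf; split; [exact: graphical_function_0inf|exact: V0].
- rewrite moebius_01; split; first exact: graphical_function_01.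
  by rewrite subr_eq0 eq_sym z1 -subr_eq0 addrAC subrr sub0r oppr_eq0.
- by rewrite moebius_1z; split; [exact: graphical_function_1z|exact: V0].
Qed.
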